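(* (Borcherds identity) For every three elements $a,b,c$ in a logarithmic vertex algebra $V$ with braiding map $\mathcal S$ and every $n\in\mathbb Z$, we have the identity $$\iota_{z_1,z_2}Y(z_1)(I\otimes Y(z_2))z_{12}^ne^{\vartheta_{12}\mathcal S_{12}}(a\otimes b\otimes c)-(-1)^{p(a)p(b)}\iota_{z_2,z_1}Y(z_2)(I\otimes Y(z_1))z_{12}^ne^{\vartheta_{21}\mathcal S_{12}}(b\otimes a\otimes c)$$ $$=\sum_{j\in\mathbb Z_+}Y(z_2)(\mu_{(n+j)}\otimes I)D_{z_2}^{(j)}\delta_{\mathcal S_{13}}(z_1,z_2)(a\otimes b\otimes c).$$
   Context: Conventions. All superspaces, tensor products and Hom's are over $\mathbb C$; $p(v)$ is the parity; formulas with $p$ are for homogeneous elements, extended linearly. $(\phi\otimes\psi)(a\otimes b)=(-1)^{p(\psi)p(a)}\phi(a)\otimes\psi(b)$; $[\cdot,\cdot]$ is the supercommutator; $P(a\otimes b)=(-1)^{p(a)p(b)}b\otimes a$; $I$ is the identity. $z,z_1,z_2$, $\zeta,\zeta_1,\zeta_2$ are commuting even formal variables ($\zeta_i$ plays the role of $\log z_i$). $D_z=\partial_z+z^{-1}\partial_\zeta$, $D_{z_i}=\partial_{z_i}+z_i^{-1}\partial_{\zeta_i}$, $x^{(k)}=x^k/k!$, $z_{12}=z_1-z_2$, $\vartheta_{12}=\zeta_1-\sum_{n\ge1}\frac1n z_1^{-n}z_2^n$, $\vartheta_{21}=\zeta_2-\sum_{n\ge1}\frac1n z_1^{n}z_2^{-n}$.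 $\mathrm{LF}(V)=\mathrm{Hom}(V,V(\!(z)\!)[\zeta])$ with its natural superspace structure. Braiding map. A braiding map on $V$ is an even element $\mathcal S\in\mathrm{End}(V)\otimes\mathrm{End}(V)$ with $\mathcal SP=P\mathcal S$ and $[\mathcal S_{12},\mathcal S_{23}]=[\mathcal S_{13},\mathcal S_{23}]=[\mathcal S_{12},\mathcal S_{13}]=0$ on $V^{\otimes3}$, where $\mathcal S_{12}=\mathcal S\otimes I$, $\mathcal S_{23}=I\otimes\mathcal S$, $\mathcal S_{13}=(I\otimes P)\mathcal S_{12}(I\otimes P)$. Logarithmic vertex algebra (logVA) $(V,\boldsymbol1,T,Y,\mathcal S)$: a superspace $V$, an even vector $\boldsymbol1$, an even $T\in\mathrm{End}(V)$, an even linear map $Y:V\to\mathrm{LF}(V)$, $a\mapsto Y(a,z)$, and a braiding map $\mathcal S$ on $V$ such that, with $Y(z)(a\otimes b):=Y(a,z)b$: (vacuum) $Y(\boldsymbol1,z)=I$, $Y(a,z)\boldsymbol1\in V[\![z]\!]$, $Y(a,z)\boldsymbol1|_{z=0}=a$, $T\boldsymbol1=0$; (covariance) $[T,Y(a,z)]=D_zY(a,z)$; (nilpotence) $\mathcal S$ is locally nilpotent on $V\otimes V$; (locality) for all $a,b\in V$ there is $N\in\mathbb Z_+$ such that for all $c\in V$, $Y(z_1)(I\otimes Y(z_2))z_{12}^Ne^{\vartheta_{12}\mathcal S_{12}}(a\otimes b\otimes c)=(-1)^{p(a)p(b)}Y(z_2)(I\otimes Y(z_1))z_{12}^Ne^{\vartheta_{21}\mathcal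 S_{12}}(b\otimes a\otimes c)$; (hexagon) $\mathcal S(Y(z)\otimes I)=(Y(z)\otimes I)(\mathcal S_{13}+\mathcal S_{23})$ on $V^{\otimes3}$. Notation. Modes: $Y(a,z)|_{\zeta=0}=\sum_{n\in\mathbb Z}a_{(n+\mathcal S)}z^{-n-1}$, and $\mu_{(n)}:V\otimes V\to V$, $\mu_{(n)}(a\otimes b)=a_{(n+\mathcal S)}b$. $\iota_{z_1,z_2}$ (resp. $\iota_{z_2,z_1}$) denotes expanding integer powers of $z_{12}$ in the domain $|z_1|>|z_2|$ (resp. $|z_2|>|z_1|$). $\delta(z_1,z_2)=\sum_{n\in\mathbb Z}z_1^{-n-1}z_2^n$ and, for a locally nilpotent operator $\mathcal N$ (here $\mathcal N=\mathcal S_{13}$), $\delta_{\mathcal N}(z_1,z_2)=\delta(z_1,z_2)e^{(\zeta_2-\zeta_1)\mathcal N}$. The derivative $D_{z_2}^{(j)}$ acts only on $\delta_{\mathcal S_{13}}(z_1,z_2)$. *)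

(* Defs.v *)
From HB Require Import structures.
From mathcomp Require Import all_boot all_order all_algebra.
From mathcomp Require Import generic_quotient sesquilinear.
From mathcomp Require Import boolp classical_sets functions cardinality fsbigop.
From mathcomp Require Import reals complex.

Set Implicit Arguments.
Unset Strict Implicit.
Unset Printing Implicit Defensive.

Import GRing.Theory.

Local Open Scope ring_scope.
Local Open Scope quotient_scope.
Local Open Scope classical_set_scope.

(** The base field [K] is meant to be the field of complex numbers [R[i]],
    [R : realType]; the divisions by integers below need characteristic 0. *)

(** [tensor V W] is the set of finite formal sums of pairs (v, w), modulo
    the congruence identifying two sums when no bilinear map separates them. *)

Section Tensor.
Variables (K : fieldType) (V W : lmodType K).
Implicit Types s t : seq (V * W).

Definition tsum (X : lmodType K) (f : V -> W -> X) s : X :=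
  \sum_(vw <- s) f vw.1 vw.2.

Definition teq s t : bool :=
  `[< forall (X : lmodType K) (f : {bilinear V -> W -> X}),
        tsum f s = tsum f t >].

Lemma teq_refl : reflexive teq.
Proof. by move=> s; apply/asboolP. Qed.
Lemma teq_sym : symmetric teq.
Proof.
by move=> s t; apply/asboolP/asboolP => st X f; rewrite st.
Qed.
Lemma teq_trans : transitive teq.
Proof.
by move=> t s u /asboolP st /asboolP tu; apply/asboolP => X f; rewrite st tu.
Qed.

Canonical teq_equiv := EquivRel teq teq_refl teq_sym teq_trans.

Definition tensor := {eq_quot teq}%qT.
HB.instance Definition _ := Quotient.on tensor.
HB.instance Definition _ := EqQuotient.on tensor.
HB.instance Definition _ := Choice.on tensor.

Definition tlift (X : lmodType K) (f : V -> W -> X) (x : tensor) : X :=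
  tsum f (repr x).

Definition tscale_seq (k : K) s := [seq (k *: vw.1, vw.2) | vw <- s].

Definition tens (v : V) (w : W) : tensor := \pi_tensor [:: (v, w)].
Definition tzero : tensor := \pi_tensor [::].
Definition tadd (x y : tensor) : tensor := \pi_tensor (repr x ++ repr y).
Definition tscale (k : K) (x : tensor) : tensor :=
  \pi_tensor (tscale_seq k (repr x)).

Lemma tlift_pi (X : lmodType K) (f : {bilinear V -> W -> X}) s :
  tlift f (\pi_tensor s) = tsum f s.
Proof.
have /eqmodP/asboolP E : repr (\pi_tensor s) = s %[mod tensor] by rewrite reprK.
exact: E.
Qed.

Lemma tensorP (x y : tensor) :
  (forall (X : lmodType K) (f : {bilinear V -> W -> X}),
     tlift f x = tlift f y) -> x = y.
Proof.
by move=> xy; rewrite -[x]reprK -[y]reprK; apply/eqmodP/asboolP => X f; exact: xy.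
Qed.

Lemma tsum_scale (X : lmodType K) (f : {bilinear V -> W -> X}) k s :
  tsum f (tscale_seq k s) = k *: tsum f s.
Proof.
by rewrite /tsum big_map scaler_sumr; apply: eq_bigr => vw _; rewrite linearZl_LR.
Qed.

Lemma tlift_add (X : lmodType K) (f : {bilinear V -> W -> X}) x y :
  tlift f (tadd x y) = tlift f x + tlift f y.
Proof. by rewrite tlift_pi /tsum big_cat. Qed.
Lemma tlift_zero (X : lmodType K) (f : {bilinear V -> W -> X}) :
  tlift f tzero = 0.
Proof. by rewrite tlift_pi /tsum big_nil. Qed.
Lemma tlift_scale (X : lmodType K) (f : {bilinear V -> W -> X}) k x :
  tlift f (tscale k x) = k *: tlift f x.
Proof. by rewrite tlift_pi tsum_scale. Qed.

Let tE := (tlift_add, tlift_zero, tlift_scale).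

Lemma taddA : associative tadd.
Proof. by move=> x y z; apply: tensorP => X f; rewrite !tE addrA. Qed.
Lemma taddC : commutative tadd.
Proof. by move=> x y; apply: tensorP => X f; rewrite !tE addrC. Qed.
Lemma tadd0 : left_id tzero tadd.
Proof. by move=> x; apply: tensorP => X f; rewrite !tE add0r. Qed.
Lemma taddN : left_inverse tzero (tscale (-1)) tadd.
Proof. by move=> x; apply: tensorP => X f; rewrite !tE scaleN1r addNr. Qed.

HB.instance Definition _ := GRing.isZmodule.Build tensor taddA taddC tadd0 taddN.

Lemma tscaleA k l x : tscale k (tscale l x) = tscale (k * l) x.
Proof. by apply: tensorP => X f; rewrite !tE scalerA. Qed.
Lemma tscale1 : left_id 1 tscale.
Proof. by move=> x; apply: tensorP => X f; rewrite !tE scale1r. Qed.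
Lemma tscaleDr : right_distributive tscale +%R.
Proof. by move=> k x y; apply: tensorP => X f; rewrite !tE scalerDr. Qed.
Lemma tscaleDl x : {morph tscale^~ x : k l / k + l}.
Proof. by move=> k l; apply: tensorP => X f; rewrite !tE scalerDl. Qed.

HB.instance Definition _ :=
  GRing.Zmodule_isLmodule.Build K tensor tscaleA tscale1 tscaleDr tscaleDl.

Lemma tlift_is_linear (X : lmodType K) (f : {bilinear V -> W -> X}) :
  linear (tlift f).
Proof. by move=> k x y; rewrite tlift_add tlift_scale. Qed.

HB.instance Definition _ (X : lmodType K) (f : {bilinear V -> W -> X}) :=
  GRing.isLinear.Build K tensor X *:%R (tlift f) (tlift_is_linear f).

Lemma tlift_tens (X : lmodType K) (f : {bilinear V -> W -> X}) v w :
  tlift f (tens v w) = f v w.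
Proof. by rewrite tlift_pi /tsum big_seq1. Qed.

Lemma tens_is_bilinear : bilinear_for *:%R *:%R tens.
Proof.
split=> [w k v v'|v k w w']; apply: tensorP => X f.
  by rewrite linearP /= !tlift_tens linearPl.
by rewrite linearP /= !tlift_tens linearPr.
Qed.

HB.instance Definition _ :=
  bilinear_isBilinear.Build K V W tensor *:%R *:%R tens tens_is_bilinear.

Lemma tens_sum (x : tensor) : x = \sum_(vw <- repr x) tens vw.1 vw.2.
Proof.
apply: tensorP => X f; rewrite linear_sum /=.
by under eq_bigr do rewrite tlift_tens.
Qed.

Lemma tens_ext (X : lmodType K) (f g : {linear tensor -> X}) :
  (forall v w, f (tens v w) = g (tens v w)) -> f =1 g.
Proof.
move=> fg x; rewrite (tens_sum x) !linear_sum /=.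
by apply: eq_bigr => vw _; exact: fg.
Qed.

End Tensor.

Notation "v '⊗' w" := (tens v w) (at level 38, left associativity) : ring_scope.

Section Bilift.
Variables (K : fieldType) (V W X : lmodType K) (f : V -> W -> X).

Definition mkbilin & bilinear_for *:%R *:%R f := f.

Variable fP : bilinear_for *:%R *:%R f.
HB.instance Definition _ :=
  bilinear_isBilinear.Build K V W X *:%R *:%R (mkbilin fP) fP.

Definition bilift : {linear tensor V W -> X} := tlift (mkbilin fP).

Lemma biliftE x : bilift x = \sum_(vw <- repr x) f vw.1 vw.2.
Proof. by []. Qed.

Lemma bilift_tens v w : bilift (v ⊗ w) = f v w.
Proof. exact: tlift_tens. Qed.

End Bilift.
Arguments bilift : simpl never.

Section TensorMaps.
Variable K : fieldType.

Lemma tmap_bilin (V W V' W' : lmodType K)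
    (f : {linear V -> V'}) (g : {linear W -> W'}) :
  bilinear_for *:%R *:%R (fun v w => f v ⊗ g w).
Proof.
by split=> [w k v v'|v k w w'] /=; rewrite linearP (linearPl, linearPr).
Qed.

(** f ⊗ g without the Koszul sign; it is only used when f or g is an
    identity and g is even. *)
Definition tmap (V W V' W' : lmodType K)
    (f : {linear V -> V'}) (g : {linear W -> W'}) :
  {linear tensor V W -> tensor V' W'} := bilift (tmap_bilin f g).

Lemma tassoc1_bilin (V W X : lmodType K) (x : X) :
  bilinear_for *:%R *:%R (fun (v : V) (w : W) => v ⊗ (w ⊗ x)).
Proof.
by split=> [w k v v'|v k w w'] /=; rewrite ?linearPl // linearPr.
Qed.

Lemma tassoc_bilin (V W X : lmodType K) :
  bilinear_for *:%R *:%R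
    (fun (t : tensor V W) (x : X) => bilift (tassoc1_bilin V W x) t).
Proof.
split=> [x k t t'|t k x x']; first by rewrite linearP.
rewrite /= !biliftE scaler_sumr -big_split /=.
by apply: eq_bigr => vw _; rewrite !linearPr.
Qed.

Definition tassoc (V W X : lmodType K) :
  {linear tensor (tensor V W) X -> tensor V (tensor W X)} :=
  bilift (@tassoc_bilin V W X).

Lemma tassoc_tens (V W X : lmodType K) (v : V) (w : W) (x : X) :
  tassoc V W X (v ⊗ w ⊗ x) = v ⊗ (w ⊗ x).
Proof. by rewrite !bilift_tens. Qed.

Lemma tassocV1_bilin (V W X : lmodType K) (v : V) :
  bilinear_for *:%R *:%R (fun (w : W) (x : X) => v ⊗ w ⊗ x).
Proof.
by split=> [w k x x'|w k x x'] /=; rewrite linearPr // linearPl.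
Qed.

Lemma tassocV_bilin (V W X : lmodType K) :
  bilinear_for *:%R *:%R
    (fun (v : V) (t : tensor W X) => bilift (tassocV1_bilin W X v) t).
Proof.
split=> [t k v v'|v k t t']; last by rewrite linearP.
rewrite /= !biliftE scaler_sumr -big_split /=.
by apply: eq_bigr => vw _; rewrite !linearPl.
Qed.

Definition tassocV (V W X : lmodType K) :
  {linear tensor V (tensor W X) -> tensor (tensor V W) X} :=
  bilift (@tassocV_bilin V W X).

Lemma tassocV_tens (V W X : lmodType K) (v : V) (w : W) (x : X) :
  tassocV V W X (v ⊗ (w ⊗ x)) = v ⊗ w ⊗ x.
Proof. by rewrite !bilift_tens. Qed.

End TensorMaps.

(** The decomposition V = V_0 ⊕ V_1 is given by its two projections
    [part false] onto V_0 and [part true] onto V_1. *)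

HB.mixin Record isSuperspace (K : fieldType) V of GRing.Lmodule K V := {
  part : bool -> {linear V -> V};
  part_sum : forall v : V, part false v + part true v = v;
  part_part : forall p q (v : V),
    part p (part q v) = if p == q then part q v else 0
}.

#[short(type="superType")]
HB.structure Definition Superspace (K : fieldType) :=
  { V of isSuperspace K V & GRing.Lmodule K V }.

Section Super.
Variables (K : fieldType) (V : superType K).

Definition has_parity (p : bool) (v : V) : Prop := part p v = v.

(** (-1)^(p(a)p(b)) f(a, b), extended linearly to all a and b. *)
Definition koszul (X : lmodType K) (f : V -> V -> X) (a b : V) : X :=
  \sum_(p : bool) \sum_(q : bool) (-1) ^+ (p && q) *: f (part p a) (part q b).

Lemma part_homog p q (a : V) :
  has_parity p a -> part q a = if q == p then a else 0.
Proof. by move=> pa; rewrite -{1}pa part_part pa. Qed.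

Lemma koszul_homog (X : lmodType K) (f : V -> V -> X) p q a b :
  (forall b, f 0 b = 0) -> (forall a, f a 0 = 0) ->
  has_parity p a -> has_parity q b ->
  koszul f a b = (-1) ^+ (p && q) *: f a b.
Proof.
move=> f0l f0r pa qb; rewrite /koszul !big_bool /=.
rewrite !(part_homog _ pa) !(part_homog _ qb).
by case: p q {pa qb} => [] []; rewrite /= ?f0l ?f0r ?scaler0 ?add0r ?addr0.
Qed.

Lemma koszul_bilin (X : lmodType K) (f : V -> V -> X) :
  bilinear_for *:%R *:%R f -> bilinear_for *:%R *:%R (koszul f).
Proof.
move=> [fl fr]; split=> [b k a a'|a k b b'] /=; rewrite /koszul;
rewrite scaler_sumr -big_split; apply: eq_bigr => p _;
rewrite scaler_sumr -big_split; apply: eq_bigr => q _ /=;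
by rewrite linearP ?[f (_ + _) _]fl ?fr scalerDr !scalerA mulrC.
Qed.

Lemma flip_bilin : bilinear_for *:%R *:%R (fun a b : V => b ⊗ a).
Proof.
by split=> [w k v v'|v k w w'] /=; rewrite (linearPl, linearPr).
Qed.

(** P(a ⊗ b) = (-1)^(p(a)p(b)) b ⊗ a *)
Definition flip : {linear tensor V V -> tensor V V} :=
  bilift (koszul_bilin flip_bilin).

Definition homog_map (q : bool) (f : V -> V) : Prop :=
  forall p v, has_parity p v -> has_parity (p (+) q) (f v).

Lemma stmap_bilin (q : bool) (f g : {linear V -> V}) :
  bilinear_for *:%R *:%R
    (fun a b => \sum_(p : bool) (-1) ^+ (q && p) *: (f (part p a) ⊗ g b)).
Proof.
split=> [b k a a'|a k b b'] /=;
rewrite scaler_sumr -big_split; apply: eq_bigr => p _ /=;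
by rewrite !linearP (linearPl, linearPr) scalerDr !scalerA mulrC.
Qed.

(** f ⊗ g for g of parity q: a ⊗ b |-> (-1)^(q p(a)) f(a) ⊗ g(b). *)
Definition stmap (q : bool) (f g : {linear V -> V}) :
  {linear tensor V V -> tensor V V} := bilift (stmap_bilin q f g).

(** V ⊗ V ⊗ V is (V ⊗ V) ⊗ V. *)
Definition tensor3 : lmodType K := tensor (tensor V V) V.

Definition op12 (S : {linear tensor V V -> tensor V V}) :
  {linear tensor3 -> tensor3} := tmap S idfun.
Definition op23 (S : {linear tensor V V -> tensor V V}) :
  {linear tensor3 -> tensor3} :=
  tassocV V V V \o tmap idfun S \o tassoc V V V.
Definition op13 (S : {linear tensor V V -> tensor V V}) :
  {linear tensor3 -> tensor3} := op23 flip \o op12 S \o op23 flip.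

(** The even elements of End(V) ⊗ End(V), seen as operators on V ⊗ V: finite
    sums of f ⊗ g with f and g homogeneous of the same parity. *)
Definition even_End2 (S : {linear tensor V V -> tensor V V}) : Prop :=
  exists (n : nat) (q : 'I_n -> bool) (f g : 'I_n -> {linear V -> V}),
    (forall i, homog_map (q i) (f i) /\ homog_map (q i) (g i)) /\
    forall x, S x = \sum_(i < n) stmap (q i) (f i) (g i) x.

(** All the operators involved are even, so that their supercommutators are
    commutators. *)
Definition commute_ops (X : Type) (A B : X -> X) : Prop :=
  forall x, A (B x) = B (A x).

Definition braiding_map (S : {linear tensor V V -> tensor V V}) : Prop :=
  [/\ even_End2 S,
      commute_ops S flip,
      commute_ops (op12 S) (op23 S),
      commute_ops (op13 S) (op23 S) &
      commute_ops (op12 S) (op13 S)].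

Definition locally_nilpotent (X : lmodType K) (A : X -> X) : Prop :=
  forall x, exists n : nat, iter n A x = 0.

End Super.

(** [mon1] indexes the monomials z^i ζ^k (i an integer, k a natural number)
    and [mon2] the monomials z_1^i ζ_1^k z_2^j ζ_2^l. A formal series with
    coefficients in X is a function from monomials to X. *)

Notation mon1 := (int * nat)%type.
Notation mon2 := ((int * nat) * (int * nat))%type.

Section Series.
Variable K : fieldType.

(** Infinite sums and products are computed coefficientwise, by sums
    [\sum_(i \in A) F i] over those i in A with F i != 0. Such a sum is 0 by
    convention when there are infinitely many of these, which never happens
    below: the series involved are such that the sums are finite. *)
Definition formal_sum (I J : choiceType) (X : nmodType) (A : set J)
    (F : J -> I -> X) : I -> X := fun m => \sum_(j \in A) F j m.

Definition cauchy (I : nmodType) (A B : Type) (X : nmodType)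
    (op : A -> B -> X) (f : I -> A) (g : I -> B) : I -> X :=
  fun m => \sum_(pq \in [set pq : I * I | pq.1 + pq.2 = m])
             op (f pq.1) (g pq.2).

Definition smul (I : nmodType) (X : lmodType K) (f : I -> K) (g : I -> X) :
  I -> X := cauchy (fun k x => k *: x) f g.

Definition sapp (I X W : nmodType) (A : I -> X -> W) (g : I -> X) : I -> W :=
  cauchy (fun h x => h x) A g.

Definition monom (I : nmodType) (m : I) : I -> K := fun q => (q == m)%:R.

Definition spow (I : nmodType) (f : I -> K) (n : nat) : I -> K :=
  iter n (cauchy *%R f) (monom 0).

(** e^(θ N) x = Σ_k (θ^k / k!) N^k x *)
Definition sexp (I : nmodType) (X : lmodType K) (theta : I -> K)
    (N : X -> X) (x : X) : I -> X :=
  formal_sum [set: nat] (fun k m => (spow theta k m / k`!%:R) *: iter k N x).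

(** z_1^i z_2^j *)
Definition zz (i j : int) : mon2 -> K := monom ((i, 0%N), (j, 0%N)).
Definition zeta1 : mon2 -> K := monom ((0, 1%N), (0, 0%N)).
Definition zeta2 : mon2 -> K := monom ((0, 0%N), (0, 1%N)).
Definition z12 : mon2 -> K := zz 1 0 - zz 0 1.

Definition theta12 : mon2 -> K :=
  zeta1 - formal_sum [set n : nat | (0 < n)%N]
            (fun n m => n%:R^-1 * zz (- n%:Z) n m).
Definition theta21 : mon2 -> K :=
  zeta2 - formal_sum [set n : nat | (0 < n)%N]
            (fun n m => n%:R^-1 * zz n (- n%:Z) m).

(** n (n - 1) ... (n - j + 1) / j! *)
Definition binz (n : int) (j : nat) : K :=
  (\prod_(i < j) (n%:~R - i%:R)) / j`!%:R.

(** z_12^n expanded for |z_1| > |z_2| and for |z_2| > |z_1|. *)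
Definition iota12 (n : int) : mon2 -> K :=
  formal_sum [set: nat]
    (fun j m => binz n j * (-1) ^+ j * zz (n - j%:Z) j m).
Definition iota21 (n : int) : mon2 -> K :=
  formal_sum [set: nat]
    (fun j m => binz n j * (-1) ^ (n - j%:Z) * zz j (n - j%:Z) m).

Definition delta : mon2 -> K :=
  formal_sum [set: int] (fun n => zz (- n - 1) n).

Definition deltaN (X : lmodType K) (N : X -> X) (x : X) : mon2 -> X :=
  smul delta (sexp (zeta2 - zeta1) N x).

(** D_z = ∂_z + z^(-1) ∂_ζ *)
Definition Dz (X : lmodType K) (f : mon1 -> X) : mon1 -> X := fun m =>
  (m.1 + 1)%:~R *: f (m.1 + 1, m.2) + m.2.+1%:R *: f (m.1 + 1, m.2.+1).

Definition Dz2 (X : lmodType K) (f : mon2 -> X) : mon2 -> X := fun m =>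
  Dz (fun q => f (m.1, q)) m.2.

Definition Dz2_div (X : lmodType K) (j : nat) (f : mon2 -> X) : mon2 -> X :=
  fun m => j`!%:R^-1 *: iter j (@Dz2 X) f m.

Definition in_z1 (X : nmodType) (f : mon1 -> X) : mon2 -> X :=
  fun m => if m.2 == 0 then f m.1 else 0.
Definition in_z2 (X : nmodType) (f : mon1 -> X) : mon2 -> X :=
  fun m => if m.1 == 0 then f m.2 else 0.

(** X((z))[ζ] *)
Definition laurent_log (X : nmodType) (f : mon1 -> X) : Prop :=
  (exists M : nat, forall (i : int) (k : nat), (M <= k)%N -> f (i, k) = 0) /\
  (forall k : nat, exists N : int, forall i : int, i < N -> f (i, k) = 0).

End Series.

Section Fields.
Variables (K : fieldType) (V : superType K).
Variable Y : {bilinear V -> V -> (mon1 -> V)}.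

Lemma Ycoef_bilin (m : mon1) : bilinear_for *:%R *:%R (fun a b => Y a b m).
Proof.
split=> [b k a a'|a k b b'] /=; first by rewrite linearPl.
by rewrite linearPr.
Qed.

(** Y(z) : V ⊗ V -> V((z))[ζ], by its coefficients. *)
Definition Yz (m : mon1) : {linear tensor V V -> V} := bilift (Ycoef_bilin m).

Definition IYz (m : mon1) : {linear tensor3 V -> tensor V V} :=
  tmap idfun (Yz m) \o tassoc V V V.

(** Y(z_1)(I ⊗ Y(z_2)) F and Y(z_2)(I ⊗ Y(z_1)) F *)
Definition YIY12 (F : mon2 -> tensor3 V) : mon2 -> V :=
  sapp (in_z1 (fun m => Yz m : tensor V V -> V))
    (sapp (in_z2 (fun m => IYz m : tensor3 V -> tensor V V)) F).
Definition YIY21 (F : mon2 -> tensor3 V) : mon2 -> V :=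
  sapp (in_z2 (fun m => Yz m : tensor V V -> V))
    (sapp (in_z1 (fun m => IYz m : tensor3 V -> tensor V V)) F).

(** μ_(n)(a ⊗ b) is the coefficient of z^(-n-1) ζ^0 in Y(a, z) b. *)
Definition mu (n : int) : {linear tensor V V -> V} := Yz (- n - 1, 0%N).

End Fields.

Record logVA (K : fieldType) (V : superType K) := LogVA {
  vac : V;
  transl : {linear V -> V};
  Y : {bilinear V -> V -> (mon1 -> V)};
  braid : {linear tensor V V -> tensor V V};
  vac_even : has_parity false vac;
  transl_even : homog_map false transl;
  Y_laurent_log : forall a b, laurent_log (Y a b);
  Y_even : forall p q a b m, has_parity p a -> has_parity q b ->
    has_parity (p (+) q) (Y a b m);
  braidP : braiding_map braid;
  Y_vacl : forall b m, Y vac b m = if m == 0 then b else 0;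
  Y_vacr : forall a (i : int) (k : nat),
    (i < 0) || (0 < k)%N -> Y a vac (i, k) = 0;
  Y_vacr0 : forall a, Y a vac (0, 0%N) = a;
  transl_vac : transl vac = 0;
  covariance : forall a b,
    (fun m => transl (Y a b m) - Y a (transl b) m) = Dz (Y a b);
  braid_nilpotent : locally_nilpotent braid;
  locality : forall a b, exists N : nat, forall c,
    YIY12 Y (smul (spow (z12 K) N) (sexp (theta12 K) (op12 braid) (a ⊗ b ⊗ c)))
    = koszul (fun a' b' =>
        YIY21 Y (smul (spow (z12 K) N)
                  (sexp (theta21 K) (op12 braid) (b' ⊗ a' ⊗ c)))) a b;
  hexagon : forall (m : mon1) (x : tensor3 V),
    braid (tmap (Yz Y m) idfun x) =
    tmap (Yz Y m) idfun (op13 braid x + op23 braid x)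
}.

(* Main.v *)
(* Taking c = 1 in locality shows that Y(z) = X(z) e^(-zeta S) with X(z) free of
   logarithms, and the hexagon identity and its mirror image move all the
   exponentials to the right. Both sides then end with the same factor
   e^(-zeta_1 S13 - zeta_2 S23), and what remains is an identity between modes in
   which the binomials C(n, j), C(m, j) of the classical Borcherds identity are
   replaced by C(n + S12, j), C(m + S13, j).

   The difference J of the two sides is annihilated by a power of z_12, by
   locality of a and b. Locality of a and c together with skew-symmetry,
   X(z) = e^(zT) X(-z) P, gives associativity, that is, the modes of J with large
   m vanish. Together these force J = 0. *)

(* With t = z_2/z_1, the kernel is z_12^n e^(theta12 S12) = z_1^n e^(zeta_1 S12) (1 - t)^(n + S12),
   which is where binomial(n + S12, j) comes from. The outer field brings e^(-zeta_1 S), which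
   crosses the inner one as e^(-zeta_1 (S12 + S13)), and the factor e^(zeta_1 S12) of the kernel
   cancels the S12 part.

   S is only locally nilpotent, so binomial identities are needed for operators: Vandermonde's
   identity for commuting operators replaces the numerical one, and its consequence [bop_conv] makes
   the two expansions in associativity agree ([translate_binomial]).

   Fields are truncated only vector by vector, and a sum with infinite support counts as 0. Bounds
   are therefore taken on the whole orbit of x under S12 or S13. They then hold for [bop n N j x]
   with all n and j at once, so that a truncation depends on x and on one mode index only. The final
   descent on n rests on this uniformity: its two vanishing thresholds do not depend on the
   remaining indices. *)
From HB Require Import structures.
Require Import Defs.
From mathcomp Require Import all_boot all_order all_algebra.
From mathcomp Require Import boolp classical_sets functions fsbigop.
From mathcomp Require Import reals complex zify ring.

Import GRing.Theory.
Local Open Scope ring_scope.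
Local Open Scope complex_scope.
Local Open Scope classical_set_scope.

Set Implicit Arguments.
Unset Strict Implicit.
Unset Printing Implicit Defensive.

(** * Binomials and exponentials of an operator *)

Section Operators.
Variables (K : numFieldType).

Lemma nat_neq0 (n : nat) : n.+1%:R != 0 :> K.
Proof. by rewrite Num.Theory.pnatr_eq0. Qed.

Lemma fact_neq0 (n : nat) : n`!%:R != 0 :> K.
Proof. by rewrite Num.Theory.pnatr_eq0 -lt0n fact_gt0. Qed.

(* [bop n N j] is the operator binomial(n + N, j). *)
Fixpoint bop {X : lmodType K} (n : int) (N : X -> X) (j : nat) (x : X) : X :=
  if j is i.+1 then
    i.+1%:R^-1 *: ((n - i%:Z)%:~R *: bop n N i x + N (bop n N i x))
  else x.

Definition eop {X : lmodType K} (r : nat) (N : X -> X) (x : X) : X :=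
  r`!%:R^-1 *: iter r N x.

Lemma iter_is_linear (X : lmodType K) (N : {linear X -> X}) r :
  linear (iter r N).
Proof. by elim: r => [|r IH] k x y //=; rewrite IH linearP. Qed.
HB.instance Definition _ (X : lmodType K) (N : {linear X -> X}) r :=
  GRing.isLinear.Build K X X *:%R (iter r N) (@iter_is_linear X N r).

Lemma eop_is_linear (X : lmodType K) (N : {linear X -> X}) r :
  linear (eop r N).
Proof.
by move=> k x y; rewrite /eop linearP /= scalerDr !scalerA mulrC.
Qed.
HB.instance Definition _ (X : lmodType K) (N : {linear X -> X}) r :=
  GRing.isLinear.Build K X X *:%R (eop r N) (@eop_is_linear X N r).

Lemma bop_is_linear (X : lmodType K) (N : {linear X -> X}) n j :
  linear (bop n N j).
Proof.
elim: j => [|j IH] k x y //=; rewrite IH [N _]linearP /=.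
set c := _%:~R; set a := bop n N j x; set b := bop n N j y.
rewrite (_ : _ + _ = k *: (c *: a + N a) + (c *: b + N b)); last first.
  by rewrite !scalerDr !scalerA [k * c]mulrC addrACA.
by rewrite scalerDr !scalerA [_ * k]mulrC.
Qed.
HB.instance Definition _ (X : lmodType K) (N : {linear X -> X}) n j :=
  GRing.isLinear.Build K X X *:%R (bop n N j) (@bop_is_linear X N n j).

Lemma iter_intertwine (T U : Type) (M : T -> T) (N : U -> U) (g : T -> U) :
  (forall x, g (M x) = N (g x)) -> forall r x, g (iter r M x) = iter r N (g x).
Proof. by move=> gMN r x; elim: r => //= r <-; rewrite gMN. Qed.

Lemma eop_intertwine (X W : lmodType K) (M : X -> X) (N : W -> W)
    (g : {linear X -> W}) : (forall x, g (M x) = N (g x)) ->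
  forall r x, g (eop r M x) = eop r N (g x).
Proof.
by move=> gMN r x; rewrite /eop linearZ /= (iter_intertwine gMN).
Qed.

Lemma bop_intertwine (X W : lmodType K) (M : X -> X) (N : W -> W)
    (g : {linear X -> W}) : (forall x, g (M x) = N (g x)) ->
  forall n j x, g (bop n M j x) = bop n N j (g x).
Proof.
move=> gMN n j x; elim: j => //= j IH.
by rewrite linearZ /= linearD linearZ /= gMN IH.
Qed.

(* Vanishing on the orbit of [x] under [N] propagates to every operator that
   is a polynomial in [N]. *)
Lemma bop_kill (X W : lmodType K) (N : {linear X -> X}) (f : {linear X -> W}) x :
  (forall i, f (iter i N x) = 0) ->
  forall n j i, f (iter i N (bop n N j x)) = 0.
Proof.
move=> f0 n; elim=> [|j IH] i //=.
have IHN : f (iter i N (N (bop n N j x))) = 0 by rewrite -(IH i.+1) iterSr.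
rewrite -[LHS]/((f \o iter i N) _) linearZ linearD linearZ /=.
by rewrite IHN IH scaler0 addr0 scaler0.
Qed.

Lemma eop_kill (X W : lmodType K) (N : {linear X -> X}) (f : {linear X -> W}) x :
  (forall i, f (iter i N x) = 0) ->
  forall r i, f (iter i N (eop r N x)) = 0.
Proof. by move=> f0 r i; rewrite !linearZ /= -iterD f0 scaler0. Qed.

Lemma eop0 (X : lmodType K) (N : X -> X) x : eop 0 N x = x.
Proof. by rewrite /eop fact0 invr1 scale1r. Qed.

Lemma eopS (X : lmodType K) (N : {linear X -> X}) r x :
  r.+1%:R *: eop r.+1 N x = N (eop r N x).
Proof.
rewrite /eop factS natrM invfM scalerA mulrA divff ?mul1r ?nat_neq0 //.
by rewrite /= linearZ.
Qed.

Lemma bopS (X : lmodType K) (N : X -> X) n j x :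
  j.+1%:R *: bop n N j.+1 x = (n - j%:Z)%:~R *: bop n N j x + N (bop n N j x).
Proof. by rewrite /= scalerA divff ?scale1r ?nat_neq0. Qed.

Lemma scalerI_nat (X : lmodType K) (n : nat) :
  injective (GRing.scale (n.+1%:R : K) : X -> X).
Proof. exact/scalerI/nat_neq0. Qed.

Lemma bop_pascal (X : lmodType K) (N : {linear X -> X}) n j x :
  bop (n + 1) N j.+1 x = bop n N j.+1 x + bop n N j x.
Proof.
elim: j => [|j IH].
  by rewrite /= !subr0 invr1 !scale1r rmorphD /= scalerDl scale1r addrAC.
(* Multiplying by j + 2 clears the inverses of the recursion; the factor cancels in characteristic
   0. The later binomial identities use the same device. *)
apply: (scalerI_nat (n := j.+1)); rewrite scalerDr !bopS IH.
set p := bop n N j.+1 x; set q := bop n N j x.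
have -> : j.+2%:R *: p = (n - j%:Z)%:~R *: q + N q + p.
  by rewrite -bopS -addn1 natrD scalerDl scale1r.
rewrite (_ : n + 1 - j.+1%:Z = n - j%:Z); last by lia.
rewrite (_ : n - j.+1%:Z = n - j%:Z - 1); last by lia.
rewrite [(n - j%:Z - 1)%:~R]rmorphB /= scalerBl scale1r [N (p + q)]linearD /=.
rewrite scalerDr addrACA [RHS]addrA [RHS]addrAC; congr (_ + _).
by rewrite [_ - p + _]addrAC addrNK.
Qed.

Lemma sum_ord_rev (W : nmodType) n (F : nat -> W) :
  \sum_(i < n.+1) F i = \sum_(i < n.+1) F (n - i)%N.
Proof. by rewrite (reindex_inj rev_ord_inj); apply: eq_bigr => i _; rewrite /= subSS. Qed.

(** Chu-Vandermonde for commuting operators: the coefficient of t^q in (1 + t)^(m + M) (1 + t)^(n +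
    N). *)
Lemma bop_vandermonde (X : lmodType K) (M N : {linear X -> X}) :
  (forall x, M (N x) = N (M x)) -> forall m n q x,
  \sum_(i < q.+1) bop m M i (bop n N (q - i) x) = bop (m + n) (M \+ N) q x.
Proof.
move=> MN m n; elim=> [|q IH] x; first by rewrite big_ord1.
apply: (scalerI_nat (n := q)); rewrite bopS -IH /= !linear_sum /=.
pose F i := bop m M i (bop n N (q.+1 - i) x).
(* Split q + 1 = i + (q + 1 - i): the first part lowers the index of the binomial in M, the second
   that of the binomial in N. *)
have -> : \sum_(i < q.+2) q.+1%:R *: F i =
  \sum_(i < q.+2) i%:R *: F i + \sum_(i < q.+2) (q.+1 - i)%:R *: F i.
  rewrite -big_split; apply: eq_bigr => i _ /=.
  by rewrite -scalerDl -natrD subnKC // -ltnS.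
rewrite big_ord_recl scale0r add0r.
rewrite [X in _ + X = _]big_ord_recr /= subnn scale0r addr0 -!big_split /=.
apply: eq_bigr => i _; rewrite /bump /= add1n /F subSS.
have le_iq : (i <= q)%N by rewrite -ltnS.
have Mb j y : bop m M j (N y) = N (bop m M j y).
  exact/esym/(bop_intertwine (M := M) (N := M) (g := N)).
rewrite bopS subSn //; set z := bop m M i (bop n N (q - i) x).
have -> : (q - i).+1%:R *: bop m M i (bop n N (q - i).+1 x) =
    (n - (q - i)%:Z)%:~R *: z + N z.
  by rewrite -[LHS]linearZ bopS [LHS]linearP /= Mb.
rewrite addrACA -scalerDl -rmorphD /=; congr (_%:~R *: _ + _); lia.
Qed.

(** Negation of the upper index of a binomial. *)
Lemma bop_neg (X : lmodType K) (N : {linear X -> X}) n j x :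
  bop n N j x = (-1) ^+ j *: bop (j%:Z - 1 - n) (\- N) j x.
Proof.
have E i m (y : X) : bop (m + 1) (\- N) i.+1 y = bop m (\- N) i.+1 y + bop m (\- N) i y.
  exact: (bop_pascal (\- N : {linear X -> X})).
(* Absorption: (i + 1) binomial(m + 1 - N, i + 1) = (m + 1 - N) binomial(m - N, i). *)
have F i m (y : X) : i.+1%:R *: bop (m + 1) (\- N) i.+1 y =
   (m + 1)%:~R *: bop m (\- N) i y - N (bop m (\- N) i y).
  rewrite E scalerDr bopS addrAC -scalerDl; congr (_ *: _ + _).
  by rewrite -[i.+1%:R]/(i.+1%:Z%:~R) -rmorphD /=; congr (_%:~R); lia.
elim: j n => [|j IH] n; first by rewrite scale1r.
apply: (scalerI_nat (n := j)); rewrite bopS IH.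
rewrite (_ : j.+1%:Z - 1 - n = j%:Z - 1 - n + 1); last by lia.
rewrite [RHS]scalerA mulrC -scalerA F; set b := bop _ _ _ _.
rewrite [N _]linearZ /= exprS mulN1r scaleNr -scalerN opprB scalerBr addrC.
congr (_ + _); rewrite -scalerN -scaleNr -rmorphN /= !scalerA mulrC.
by congr ((_ * _%:~R) *: _); lia.
Qed.

Lemma eq_bop (X : lmodType K) (M N : X -> X) :
  M =1 N -> forall n j (x : X), bop n M j x = bop n N j x.
Proof. by move=> /funext ->. Qed.

(** Negating the upper index turns the outer binomial into binomial(q - 1 - m - n - M - N, q - j),
    whose upper index no longer depends on j. Vandermonde then cancels n + N, and a second negation
    gives the result. *)
Lemma bop_conv (X : lmodType K) (M N : {linear X -> X}) :
  (forall x, M (N x) = N (M x)) -> forall m n q x,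
  \sum_(j < q.+1) (-1) ^+ (q - j) *:
     bop (m + n - j%:Z) (M \+ N) (q - j) (bop n N j x) =
  (-1) ^+ q *: bop m M q x.
Proof.
move=> MN m n q x.
pose G i := bop (q%:Z - 1 - m - n) (\- (M \+ N)) i (bop n N (q - i) x).
rewrite (eq_bigr (fun j : 'I_q.+1 => G (q - j)%N)); last first.
  move=> j _; have le_jq : (j <= q)%N by rewrite -ltnS.
  rewrite [bop _ (M \+ N) _ _]bop_neg scalerA -expr2 sqrr_sign scale1r /G subKn //.
  by congr (bop _ _ _ _); lia.
rewrite -sum_ord_rev (bop_vandermonde (M := \- (M \+ N)) (N := N)); last first.
  by move=> y; rewrite /= MN [N (- _)]linearN [N (_ + _)]linearD.
rewrite (eq_bop (N := \- M)) => [|y /=]; last by rewrite opprD addrNK.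
by rewrite [in RHS]bop_neg scalerA -expr2 sqrr_sign scale1r addrNK.
Qed.

Lemma eop_binomial (X : lmodType K) (M N : {linear X -> X}) :
  (forall x, M (N x) = N (M x)) -> forall k x,
  \sum_(r < k.+1) eop (k - r) M (eop r N x) = eop k (M \+ N) x.
Proof.
move=> MN; elim=> [|k IH] x; first by rewrite big_ord1 !eop0.
apply: (scalerI_nat (n := k)); rewrite eopS -IH /=.
rewrite scaler_sumr [M _]linear_sum [N _]linear_sum /=.
pose F i := eop (k.+1 - i) M (eop i N x).
have -> : \sum_(i < k.+2) k.+1%:R *: F i =
  \sum_(i < k.+2) (k.+1 - i)%:R *: F i + \sum_(i < k.+2) i%:R *: F i.
  rewrite -big_split; apply: eq_bigr => i _ /=.
  by rewrite -scalerDl -natrD subnK // -ltnS.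
rewrite [X in X + _]big_ord_recr /= subnn scale0r addr0.
rewrite [X in _ + X]big_ord_recl scale0r add0r; congr (_ + _).
  by apply: eq_bigr => i _; rewrite /F subSn ?eopS // -ltnS.
apply: eq_bigr => i _; rewrite lift0 /F subSS.
have Me j y : eop j M (N y) = N (eop j M y).
  exact/esym/(eop_intertwine (M := M) (N := M) (g := N)).
by rewrite -Me -[LHS]linearZ eopS.
Qed.

Lemma eop_zero (X : lmodType K) k (x : X) :
  eop k (\0 : X -> X) x = if k == 0%N then x else 0.
Proof. by case: k => [|k]; rewrite ?eop0 // /eop /= scaler0. Qed.

Lemma eq_eop (X : lmodType K) (M N : X -> X) :
  M =1 N -> forall k (x : X), eop k M x = eop k N x.
Proof. by move=> /funext ->. Qed.

(** Scalar binomials are the case of the zero operator, so they inherit Pascal's rule and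
    Vandermonde's identity. *)
Lemma binzE (X : lmodType K) n j (x : X) : binz K n j *: x = bop n \0 j x.
Proof.
elim: j => [|j IH] /=; first by rewrite /binz big_ord0 mul1r invr1 scale1r.
rewrite addr0 -IH !scalerA; congr (_ *: _).
rewrite /binz big_ord_recr /= factS natrM invfM rmorphB /=.
ring.
Qed.

Lemma bop_minus1 (X : lmodType K) j (x : X) : bop (-1) \0 j x = (-1) ^+ j *: x.
Proof.
elim: j => [|j IH] /=; first by rewrite scale1r.
rewrite addr0 IH !scalerA; congr (_ *: _).
have -> : (-1 - j%:Z)%:~R = - j.+1%:R :> K.
  by rewrite -[j.+1%:R]/(j.+1%:Z%:~R) -rmorphN /=; congr _%:~R; lia.
by rewrite mulrN mulVf ?nat_neq0 // exprS mulN1r.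
Qed.

End Operators.

(** * Formal series *)

Section FiniteSums.

(** An injection from a finite type that covers the support computes the sum; the covering is what
    excludes the default value 0 of infinite sums. *)
Lemma fsbig_fin (J : choiceType) (T : finType) (W : nmodType) (D : set J)
    (h : T -> J) (F : J -> W) :
  injective h -> (forall t, D (h t)) ->
  (forall x, D x -> F x <> 0 -> exists t, h t = x) ->
  \sum_(x \in D) F x = \sum_(t : T) F (h t).
Proof.
move=> hI hD hF; rewrite (fsbigE (map h (index_enum T))).
- by rewrite big_map; apply: eq_bigl => t; rewrite mem_set.
- by rewrite map_inj_uniq // index_enum_uniq.
- by move=> x /= /mapP[t _ ->].
- move=> x Dx; apply: contraNeq => /eqP/(hF _ Dx)[t <-].
  by rewrite map_f // mem_index_enum.
Qed.

Lemma cauchy_fin (I : nmodType) (A B : Type) (X : nmodType) (T : finType)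
    (op : A -> B -> X) (f : I -> A) (g : I -> B) (h : T -> I * I) m :
  injective h -> (forall t, (h t).1 + (h t).2 = m) ->
  (forall p q, p + q = m -> op (f p) (g q) <> 0 -> exists t, h t = (p, q)) ->
  cauchy op f g m = \sum_(t : T) op (f (h t).1) (g (h t).2).
Proof.
move=> hI hm hF; rewrite /cauchy (fsbig_fin (h := h)) //.
by move=> [p q] /= pq /(hF _ _ pq).
Qed.

Lemma fsbig_nat (W : nmodType) (F : nat -> W) L :
  (forall j, (L <= j)%N -> F j = 0) ->
  \sum_(j \in [set: nat]) F j = \sum_(j < L) F j.
Proof.
move=> F0; rewrite (fsbig_fin (h := @nat_of_ord L)) //; first exact: val_inj.
move=> j _ Fj; have [jL|/F0//] := ltnP j L; by exists (Ordinal jL).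
Qed.

End FiniteSums.

Section DiagonalSeries.

(* The series sum_(r, j) G r j z_1^(n - j) zeta_1^r z_2^j. *)
Definition dser (X : nmodType) (n : int) (G : nat -> nat -> X) : mon2 -> X :=
  fun m => if [&& m.2.2 == 0%N, 0 <= m.2.1 & m.1.1 + m.2.1 == n]
           then G m.1.2 `|m.2.1|%N else 0.

Lemma dser_neq0 (X : nmodType) n (G : nat -> nat -> X) m :
  dser n G m <> 0 -> exists j : nat, m = ((n - j%:Z, m.1.2), (j%:Z, 0%N)).
Proof.
case: m => [[i r] [j l]]; rewrite /dser /=; case: ifP => //.
case/and3P => /eqP -> j0 /eqP <- _; exists `|j|%N.
by congr ((_, _), (_, _)); lia.
Qed.

Lemma dserE (X : nmodType) n (G : nat -> nat -> X) i r (j : nat) :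
  i + j%:Z = n -> dser n G ((i, r), (j%:Z, 0%N)) = G r j.
Proof. by move=> <-; rewrite /dser /= eqxx. Qed.

Lemma dserP (X : nmodType) n (G : nat -> nat -> X) (F : mon2 -> X) :
  (forall m, F m <> 0 -> exists j : nat, m = ((n - j%:Z, m.1.2), (j%:Z, 0%N))) ->
  (forall r j, F ((n - j%:Z, r), (j%:Z, 0%N)) = G r j) -> F = dser n G.
Proof.
move=> F0 FG; apply/funext => m.
have [/F0[j ->]|] := pselect (F m <> 0); first by rewrite FG dserE // subrK.
move=> /contrapT Fm; rewrite Fm.
have [/dser_neq0[j mE]|/contrapT //] := pselect (dser n G m <> 0).
by move: Fm; rewrite mE FG dserE // subrK.
Qed.

Lemma eq_dser (X : nmodType) n (F G : nat -> nat -> X) :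
  (forall r j, F r j = G r j) -> dser n F = dser n G.
Proof. by move=> FG; congr dser; apply/funext => r; apply/funext => j. Qed.

Lemma cauchy_neq0 (I : nmodType) (A B : Type) (X : nmodType)
    (op : A -> B -> X) (f : I -> A) (g : I -> B) m :
  cauchy op f g m <> 0 -> exists p q, p + q = m /\ op (f p) (g q) <> 0.
Proof.
move=> c0; apply: contrapT => none; apply: c0; rewrite /cauchy.
apply: fsbig1 => -[p q] /= pq; apply: contrapT => opn; apply: none.
by exists p, q.
Qed.

(** The degree n ties the exponent of z_1 to that of z_2, so a monomial splits only along zeta_1 and
    z_2, in finitely many ways. *)
Lemma cauchy_dser (A B X : nmodType) (op : A -> B -> X) n n' F G :
  (forall b, op 0 b = 0) -> (forall a, op a 0 = 0) ->
  cauchy op (dser n F) (dser n' G) =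
  dser (n + n') (fun r j =>
    \sum_(s < r.+1) \sum_(i < j.+1) op (F s i) (G (r - s)%N (j - i)%N)).
Proof.
move=> op0l op0r.
have opn p q : op (dser n F p) (dser n' G q) <> 0 ->
    dser n F p <> 0 /\ dser n' G q <> 0.
  by move=> opn; split=> z; apply: opn; rewrite z.
apply: dserP.
  move=> m /cauchy_neq0[p [q [<- /opn[/dser_neq0[j ->] /dser_neq0[j' ->]]]]] /=.
  by exists (j + j')%N; congr ((_, _), (_, _)) => /=; lia.
move=> r j.
pose h (t : 'I_r.+1 * 'I_j.+1) : mon2 * mon2 :=
  (((n - (t.2 : nat)%:Z, t.1 : nat), ((t.2 : nat)%:Z, 0%N)),
   ((n' - (j - t.2)%N%:Z, (r - t.1)%N), ((j - t.2)%N%:Z, 0%N))).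
rewrite (cauchy_fin (h := h)).
- rewrite pair_bigA; apply: eq_bigr => -[s i] _ /=.
  by rewrite !dserE // subrK.
- move=> [s i] [s' i'] [] _ /= ss' ii' _ _ _; congr (_, _); exact: val_inj.
- move=> [s i] /=; have := ltn_ord s; have := ltn_ord i.
  by move=> *; congr ((_, _), (_, _)) => /=; rewrite /GRing.add /=; lia.
- move=> p q pq /opn[/dser_neq0[a pE] /dser_neq0[b qE]].
  move: pq; rewrite pE qE => -[] _ rE jE.
  have ja : (a < j.+1)%N by lia.
  have rs : (p.1.2 < r.+1)%N by rewrite -rE /GRing.add /=; lia.
  exists (Ordinal rs, Ordinal ja); rewrite /h /=.
  have -> : (j - a)%N = b by lia.
  by have -> : (r - p.1.2)%N = q.1.2 by rewrite -rE /GRing.add /=; lia.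
Qed.

End DiagonalSeries.

Section ConcreteSeries.
Variable K : numFieldType.
Implicit Type X : lmodType K.

Lemma zzE i j (m : mon2) : zz K i j m = (m == ((i, 0%N), (j, 0%N)))%:R.
Proof. by []. Qed.

Lemma monom0E : monom K (0 : mon2) = dser 0 (fun r j => ((r == 0%N) && (j == 0%N))%:R).
Proof.
apply: dserP => [m|r j].
  by rewrite /monom; case: eqP => // -> _; exists 0%N.
by rewrite /monom !xpair_eqE; congr ((_ : bool)%:R); case: r j => [|r] [|j].
Qed.

Lemma formal_zz n (D : set nat) (c : nat -> K) (F : nat -> mon2 -> K) :
  (forall j m, F j m = c j * zz K (n - j%:Z) j m) ->
  formal_sum D F = dser n (fun r j => if (r == 0%N) && (j \in D) then c j else 0).
Proof.
move=> FE; apply: dserP => [m|r j].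
  move=> s0; apply: contrapT => none; apply: s0.
  rewrite /formal_sum; apply: fsbig1 => j _; rewrite FE zzE.
  have [mE|_] := eqVneq m; last by rewrite mulr0.
  by case: none; exists j; rewrite mE.
have FE' i : F i (n - j%:Z, r, (j%:Z, 0%N)) = if (r == 0%N) && (i == j) then c j else 0.
  rewrite FE zzE !xpair_eqE eqxx andbT.
  have -> : (n - j%:Z == n - i%:Z) && (r == 0%N) && (j%:Z == i%:Z) =
      (r == 0%N) && (i == j) by lia.
  by case: (r == 0%N); case: eqVneq => /= [->|]; rewrite ?mulr1 ?mulr0.
rewrite /formal_sum; have [jD|jD] := boolP (j \in D); last first.
  rewrite andbF; apply: fsbig1 => i iD; rewrite FE'.
  by case: (eqVneq i j) iD => [->|]; rewrite ?andbF // => /mem_set; rewrite (negPf jD).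
rewrite andbT (fsbigE [:: j]) //=.
- by rewrite big_cons big_nil jD addr0 FE' eqxx andbT.
- by move=> i /=; rewrite inE => /eqP ->; exact: set_mem.
- by move=> i _; rewrite inE FE' => /negPf ->; rewrite andbF.
Qed.

Lemma iota12E n : iota12 K n =
  dser n (fun r j => if r == 0%N then binz K n j * (-1) ^+ j else 0).
Proof.
rewrite /iota12 (@formal_zz n _ (fun j => binz K n j * (-1) ^+ j)) //.
by apply: eq_dser => r j; rewrite mem_set // andbT.
Qed.

Lemma theta12E : theta12 K = dser 0 (fun r j =>
  if j == 0%N then (r == 1%N)%:R else if r == 0%N then - j%:R^-1 else 0).
Proof.
rewrite /theta12 (@formal_zz 0 _ (fun j => j%:R^-1)); last by move=> j m; rewrite sub0r.
apply: dserP => [m|r j].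
  have [->|m1] := eqVneq m ((0, 1%N), (0, 0%N)); first by exists 0%N.
  rewrite !fctE /zeta1 /monom (negPf m1) sub0r => d0.
  by apply: dser_neq0 => /(congr1 -%R); rewrite oppr0 => /d0.
rewrite !fctE dserE ?subrK // /zeta1 /monom !xpair_eqE.
case: j => [|j].
  by rewrite memNset //= andbF subr0; case: r => [|[|r]].
rewrite mem_set //= ?andbF ?sub0r ?andbT.

by case: ifP => _; rewrite ?oppr0.
Qed.

(** z_12 is written as its own binomial series, whose coefficients vanish from j = 2 on, so that its
    powers can be compared with [iota12]. *)
Lemma z12E : z12 K = dser 1 (fun r j =>
  if r == 0%N then binz K 1 j * (-1) ^+ j else 0).
Proof.
have b0 : binz K 1 0 = 1 by rewrite /binz big_ord0 fact0 divr1.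
have b1 : binz K 1 1 = 1 by rewrite /binz big_ord1 subr0 divr1.
have b2 j : binz K 1 j.+2 = 0.
  by rewrite /binz big_ord_recl big_ord_recl /= /bump /= subrr mul0r mulr0 mul0r.
apply: dserP => [m|r j].
  rewrite /z12 !fctE !zzE; have [->|_] := eqVneq m ((1, 0%N), (0, 0%N)).
    by move=> _; exists 0%N.
  have [->|_] := eqVneq m ((0, 0%N), (1, 0%N)); first by move=> _; exists 1%N.
  by rewrite subrr.
rewrite /z12 !fctE !zzE !xpair_eqE.
case: j r => [|[|j]] [|r] //=; rewrite ?b0 ?b1 ?b2 ?mul0r ?mul1r ?expr0 ?expr1 /=;
  rewrite ?subr0 ?sub0r //.
Qed.

Lemma binz_pascal n j : binz K (n + 1) j.+1 = binz K n j.+1 + binz K n j.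
Proof.
have E m i : binz K m i = bop m (\0 : K^o -> K^o) i 1.
  by rewrite -binzE -[RHS]/(_ * 1) mulr1.
by rewrite !E bop_pascal.
Qed.

Lemma spow_z12 N : spow (z12 K) N = iota12 K N%:Z.
Proof.
elim: N => [|N IH].
  rewrite /spow /= monom0E iota12E; apply: eq_dser => r [|j].
    by rewrite andbT /binz big_ord0 fact0 divr1 mul1r; case: r.
  rewrite andbF /binz big_ord_recl subr0 !mul0r.
  by case: ifP.
rewrite -[spow _ _.+1]/(cauchy *%R (z12 K) (spow (z12 K) N)) IH z12E !iota12E.
rewrite cauchy_dser; [|exact: mul0r|exact: mulr0].
rewrite (_ : 1 + N%:Z = N.+1%:Z) //; apply: eq_dser => r j.
rewrite big_ord_recl [X in _ + X]big1 ?addr0 => [|s _]; last first.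
  by apply: big1 => i _; rewrite lift0 /= mul0r.
rewrite subn0 /=; have [_|_] := eqVneq r 0%N; last by apply: big1 => i _; rewrite mulr0.
case: j => [|j].
  by rewrite big_ord1 /= /binz !big_ord0 fact0 !divr1 !mul1r.
rewrite !big_ord_recl big1 => [|i _]; last first.
  rewrite !lift0 /= [binz _ _ _.+2](_ : _ = 0) ?mul0r //.
  by rewrite /binz big_ord_recl big_ord_recl /= /bump /= subrr mul0r mulr0 mul0r.
rewrite !lift0 /= addr0 subSS subn0.
have -> : binz K 1 0 = 1 by rewrite /binz big_ord0 fact0 divr1.
have -> : binz K 1 1 = 1 by rewrite /binz big_ord1 subr0 divr1.
rewrite !mul1r -[N.+1]addn1 PoszD binz_pascal exprS expr1 subn0.
by ring.
Qed.

End ConcreteSeries.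

(** * The exponential of [theta12] as an operator binomial series *)

Section Exponential.
Variable K : numFieldType.
Implicit Type X : lmodType K.

Definition theta_coef (r j : nat) : K :=
  if j == 0%N then (r == 1%N)%:R else if r == 0%N then - j%:R^-1 else 0.

(* The coefficient of zeta_1^r z_1^(-j) z_2^j in theta12^k. *)
Fixpoint theta_pow (k r j : nat) : K :=
  if k is k'.+1 then
    \sum_(s < r.+1) \sum_(i < j.+1)
      theta_coef s i * theta_pow k' (r - s)%N (j - i)%N
  else ((r == 0%N) && (j == 0%N))%:R.

Lemma spow_theta12 k : spow (theta12 K) k = dser 0 (theta_pow k).
Proof.
elim: k => [|k IH]; first by rewrite /spow /= monom0E.
rewrite -[spow _ _.+1]/(cauchy *%R (theta12 K) (spow (theta12 K) k)) IH theta12E.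
by rewrite cauchy_dser ?addr0 //; [exact: mul0r|exact: mulr0].
Qed.

(** [theta12] as a polynomial in z_2/z_1 over polynomials in zeta_1, cut at degree [M]. Powers agree
    with those of the series below degree [M], and polynomials come with a derivation. *)
Definition theta_poly (M : nat) : {poly {poly K}} :=
  \poly_(i < M) (if i == 0%N then 'X else - (i%:R^-1)%:P).

Lemma theta_polyE M k r j : (j < M)%N ->
  theta_pow k r j = ((theta_poly M ^+ k)`_j)`_r.
Proof.
elim: k r j => [|k IH] r j jM /=.
  by rewrite expr0 coef1; case: j jM => [|j] _; rewrite ?coef1 ?coef0 ?andbT ?andbF.
rewrite exprS coefM coef_sum exchange_big; apply: eq_bigr => i _.
have iM : (i < M)%N by rewrite (leq_ltn_trans _ jM) // -ltnS.
rewrite coefM; apply: eq_bigr => s _; congr (_ * _); last first.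
  by rewrite IH // (leq_ltn_trans _ jM) // leq_subr.
rewrite coef_poly iM /theta_coef; case: ifP => _; first by rewrite coefX.
by rewrite coefN coefC; case: ifP; rewrite ?oppr0.
Qed.

Arguments theta_pow : simpl never.

Lemma theta_pow0 k r : theta_pow k r 0 = (r == k)%:R.
Proof.
rewrite (@theta_polyE 1) // -horner_coef0 horner_exp horner_coef0 coef_poly /=.
by rewrite coefXn.
Qed.

(* z_2 d/dz_2 log(1 - z_2/z_1) = - sum_(i > 0) z_1^(-i) z_2^i. *)
Lemma theta_powS k r j :
  j.+1%:R * theta_pow k.+1 r j.+1 =
  - (k.+1%:R * \sum_(i < j.+1) theta_pow k r i).
Proof.
rewrite (@theta_polyE j.+2) // mulr_natl -coefMn -coef_deriv deriv_exp.
rewrite coefMn coefMn -[LHS]mulr_natl -mulrN.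
congr (_ * _).
rewrite coefM coef_sum sum_ord_rev -sumrN.
apply: eq_bigr => i _; have ij : (i <= j)%N by rewrite -ltnS.
rewrite coef_deriv coef_poly !ltnS ij /= -[_ *+ _]mulr_natl mulrN.
rewrite -polyC_natr -polyCM divff ?nat_neq0 // mulN1r coefN.
by rewrite -(@theta_polyE j.+2) // ltnS leqW ?leq_subr.
Qed.

Variables (X : lmodType K) (N : {linear X -> X}).

Lemma iter_nilp Q x : iter Q N x = 0 -> forall k, (Q <= k)%N -> iter k N x = 0.
Proof. by move=> Qx k Qk; rewrite -(subnK Qk) iterD Qx linear0. Qed.

(** Coefficients of e^(theta12 N) = e^(zeta_1 N) (1 - t)^N with t = z_2/z_1. Both sides solve f' = -
    N f / (1 - t) and agree at t = 0; [GS] and [HS] are this equation for the two sides. *)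
Lemma theta_exp Q x r j : iter Q N x = 0 ->
  \sum_(k < Q) (theta_pow k r j / k`!%:R) *: iter k N x =
  eop r N ((-1) ^+ j *: bop 0 N j x).
Proof.
move=> Qx.
pose G j := \sum_(k < Q) (theta_pow k r j / k`!%:R) *: iter k N x.
pose H j := eop r N ((-1) ^+ j *: bop 0 N j x).
rewrite -/(G j) -/(H j).
have G0 : G 0%N = H 0%N.
  rewrite /G /H expr0 scale1r /= /eop; have [rQ|Qr] := ltnP r Q.
    rewrite (bigD1 (Ordinal rQ)) //= theta_pow0 eqxx mul1r big1 ?addr0 //.
    move=> k; rewrite -val_eqE /= theta_pow0 eq_sym => /negPf ->.
    by rewrite mul0r scale0r.
  rewrite (iter_nilp Qx) // scaler0 big1 // => k _; rewrite theta_pow0.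
  by rewrite gtn_eqF ?(leq_trans _ Qr) // mul0r scale0r.
have NG i k : N (\sum_(a < i.+1) (theta_pow k r a / k`!%:R) *: iter k N x) =
    ((\sum_(a < i.+1) theta_pow k r a) / k`!%:R) *: iter k.+1 N x.
  by rewrite -scaler_suml linearZ /= mulr_suml.
have GS i : i.+1%:R *: G i.+1 = - N (\sum_(a < i.+1) G a).
  rewrite /G scaler_sumr exchange_big linear_sum /= -sumrN.
  case: Q Qx @G G0 => [|Q] Qx G G0; first by rewrite !big_ord0.
  (* Differentiation lowers the power of theta12 by one. The two unmatched terms vanish: the power 0
     has no coefficient at i + 1 > 0, and the top one on the right is killed by [Qx]. *)
  rewrite [RHS]big_ord_recr /= [LHS]big_ord_recl.
  rewrite [theta_pow ord0 r i.+1](_ : _ = 0) ?mul0r ?scale0r ?scaler0 ?add0r; last first.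
    by rewrite -[LHS]/((((r == 0%N) && false) : bool)%:R) andbF.
  rewrite NG Qx scaler0 oppr0 addr0; apply: eq_bigr => k _.
  rewrite NG lift0 scalerA mulrA theta_powS -scaleNr; congr (_ *: _).
  rewrite factS natrM invfM mulNr; congr (- _).
  by rewrite mulrACA divff ?nat_neq0 ?mul1r.
have HD i : i.+1%:R *: H i.+1 = i%:R *: H i - N (H i).
  have -> : N (H i) = eop r N ((-1) ^+ i *: N (bop 0 N i x)).
    by rewrite /H (eop_intertwine (M := N) (N := N) (g := N)) // [N _]linearZ.
  have eZ c y : c *: eop r N y = eop r N (c *: y) by rewrite [RHS]linearZ.
  rewrite /H !eZ.
  rewrite -[RHS]linearB.
  congr (eop r N _).
  rewrite [LHS]scalerA mulrC -scalerA bopS sub0r exprS mulN1r scaleNr -scalerN.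
  rewrite [_ *: (_ *: _)]scalerA mulrC -scalerA -scalerBr rmorphN /= scaleNr.
  by rewrite opprD opprK.
(* Summing the two-term recursion [HD] brings it to the form of [GS]. *)
have HS i : i.+1%:R *: H i.+1 = - N (\sum_(a < i.+1) H a).
  elim: i => [|i IH]; first by rewrite HD scale0r sub0r big_ord1.
  by rewrite HD IH [in RHS]big_ord_recr [N (_ + _)]linearD opprD.
suff: forall i a, (a <= i)%N -> G a = H a by move/(_ j j); apply.
elim=> [|i IH] a; first by rewrite leqn0 => /eqP ->.
rewrite leq_eqVlt => /predU1P[->|/IH //].
apply: (scalerI_nat (n := i)); rewrite GS HS; congr (- N _).
by apply: eq_bigr => b _; rewrite IH // -ltnS.
Qed.

End Exponential.

Section LogarithmicKernel.
Variables (K : numFieldType) (X : lmodType K) (N : {linear X -> X}).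

Lemma sexp_theta12 x : (exists Q, iter Q N x = 0) ->
  sexp (theta12 K) N x = dser 0 (fun r j => eop r N ((-1) ^+ j *: bop 0 N j x)).
Proof.
move=> [Q Qx].
have E m : sexp (theta12 K) N x m =
    \sum_(k < Q) (dser 0 (@theta_pow K k) m / k`!%:R) *: iter k N x.
  rewrite /sexp /formal_sum (fsbig_nat (L := Q)) => [|k Qk]; last first.
    by rewrite (iter_nilp Qx) // scaler0.
  by apply: eq_bigr => k _; rewrite spow_theta12.
apply: dserP => [m|r j]; rewrite E.
  move=> s0; apply: contrapT => none; apply: s0; apply: big1 => k _.
  have [/dser_neq0[j mE]|/contrapT ->] := pselect (dser 0 (@theta_pow K k) m <> 0).
    by case: none; exists j.
  by rewrite mul0r scale0r.
rewrite -(theta_exp _ _ Qx); apply: eq_bigr => k _.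
by rewrite dserE // subrK.
Qed.

(** Vandermonde merges the scalar binomials of z_12^n with those of (1 - z_2/z_1)^N into binomial(n
    + N, j). *)
Lemma smul_iota12 n x : (exists Q, iter Q N x = 0) ->
  smul (iota12 K n) (sexp (theta12 K) N x) =
  dser n (fun r j => eop r N ((-1) ^+ j *: bop n N j x)).
Proof.
move=> nilx; rewrite sexp_theta12 // iota12E /smul cauchy_dser; first last.
- by move=> a; rewrite scaler0.
- by move=> a; rewrite scale0r.
rewrite addr0; apply: eq_dser => r j.
rewrite big_ord_recl [X in _ + X]big1 ?addr0 => [|s _]; last first.
  by apply: big1 => i _; rewrite lift0 /= scale0r.
have -> : bop n N j x = \sum_(i < j.+1) bop n \0 i (bop 0 N (j - i) x).
  rewrite bop_vandermonde => [|y]; last by rewrite /= linear0.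
  by rewrite addr0; apply: eq_bop => y; rewrite /= add0r.
rewrite scaler_sumr linear_sum; apply: eq_bigr => i _ /=.
have ij : (i <= j)%N by rewrite -ltnS.
have eZ c y : c *: eop r N y = eop r N (c *: y) by rewrite [RHS]linearZ.
rewrite subn0 -binzE eZ; congr (eop r N _).
by rewrite !scalerA -mulrA -exprD subnKC // mulrC.
Qed.

End LogarithmicKernel.

(** * Exchange of the two variables *)

Section Swap.
Variable K : numFieldType.

Definition mswap (m : mon2) : mon2 := (m.2, m.1).

Lemma cauchy_swap (A B : Type) (X : nmodType) (op : A -> B -> X)
    (f : mon2 -> A) (g : mon2 -> B) m :
  cauchy op f g m = cauchy op (f \o mswap) (g \o mswap) (mswap m).
Proof.
rewrite /cauchy (reindex_fsbig (fun pq : mon2 * mon2 => (mswap pq.1, mswap pq.2))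
  [set pq | pq.1 + pq.2 = mswap m] [set pq | pq.1 + pq.2 = m]) //.
split=> [[[p1 p2] [q1 q2]] /= []|[[p1 p2] [q1 q2]] [[p1' p2'] [q1' q2']] _ _|] /=.
- by case: m => m1 m2 /= pq1 pq2; congr (_, _).
- by case=> -> -> -> ->.
- move=> [[p1 p2] [q1 q2]] /= pq; exists ((p2, p1), (q2, q1)) => //=.
  by rewrite -pq.
Qed.

Lemma mswapK : involutive mswap. Proof. by case. Qed.

Lemma spow_swap (f : mon2 -> K) k m : spow (f \o mswap) k m = spow f k (mswap m).
Proof.
elim: k m => [|k IH] m.
  rewrite /spow /= /monom; congr ((_ : bool)%:R).
  by case: m => m1 m2; rewrite !xpair_eqE andbC.
rewrite -[LHS]/(cauchy *%R (f \o mswap) (spow (f \o mswap) k) m).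
rewrite cauchy_swap; congr (cauchy _ _ _ _); apply/funext => q /=.
  by rewrite mswapK.
by rewrite IH mswapK.
Qed.

Lemma theta21E : theta21 K = theta12 K \o mswap.
Proof.
apply/funext => m; rewrite /theta21 /theta12 !fctE /=; congr (_ - _).
  by rewrite /zeta1 /zeta2 /monom; case: m => m1 m2; rewrite !xpair_eqE andbC.
rewrite /formal_sum; apply: eq_fsbigr => n _.
by rewrite !zzE; case: m => m1 m2; rewrite !xpair_eqE andbC.
Qed.

(** From z_12 = -(z_2 - z_1): the second expansion is the first one with the variables exchanged, up
    to (-1)^n. *)
Lemma iota21E n m : iota21 K n m = (-1) ^ n * iota12 K n (mswap m).
Proof.
rewrite /iota21 /iota12 /formal_sum mulr_fsumr; apply: eq_fsbigr => j _.
rewrite !zzE [_ == (_, (n - j%:Z, 0%N))](_ : _ =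
  (mswap m == (n - j%:Z, 0%N, (j%:Z, 0%N)))); last first.
  by case: m => m1 m2; rewrite !xpair_eqE andbC.
rewrite mulrA; congr (_ * _); rewrite mulrCA; congr (_ * _).
rewrite expfzDr ?oppr_eq0 ?oner_eq0 //; congr (_ * _).
by rewrite -invr_expz -exprnP invr_sign.
Qed.

Lemma sexp_swap (X : lmodType K) (N : X -> X) x :
  sexp (theta21 K) N x = sexp (theta12 K) N x \o mswap.
Proof.
apply/funext => m; rewrite /sexp /formal_sum /=; apply: eq_fsbigr => k _.
by rewrite theta21E spow_swap.
Qed.

Lemma smul_swap (X : lmodType K) (f : mon2 -> K) (g : mon2 -> X) :
  smul (f \o mswap) (g \o mswap) = smul f g \o mswap.
Proof.
apply/funext => m; rewrite /smul cauchy_swap /=.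
by congr (cauchy _ _ _ _); apply/funext => q /=; rewrite mswapK.
Qed.

Lemma spow_opp (f : mon2 -> K) k m : spow (- f) k m = (-1) ^+ k * spow f k m.
Proof.
elim: k m => [|k IH] m; first by rewrite mul1r.
rewrite -[LHS]/(cauchy *%R (- f) (spow (- f) k) m).
rewrite -[spow f _ _]/(cauchy *%R f (spow f k) m) /cauchy mulr_fsumr.
apply: eq_fsbigr => -[p q] _ /=; rewrite IH fctE exprS; ring.
Qed.

Lemma spow_z12_swap k : spow (z12 K) k = (fun m => (-1) ^+ k * spow (z12 K) k (mswap m)).
Proof.
have E : z12 K = - (z12 K \o mswap).
  apply/funext => m; rewrite /z12 !fctE /= opprB !zzE.
  case: m => m1 m2; rewrite !xpair_eqE.
  by congr ((_ : bool)%:R - (_ : bool)%:R); exact: andbC.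
by apply/funext => m; rewrite {1}E spow_opp spow_swap.
Qed.

(** No finiteness is required: for c <> 0 both sums have the same support, hence are 0 together when
    it is infinite, and for c = 0 every term vanishes. *)
Lemma scaler_fsumr (X : lmodType K) (J : choiceType) (D : set J) (F : J -> X)
    (c : K) : \sum_(j \in D) c *: F j = c *: \sum_(j \in D) F j.
Proof.
have [->|c0] := eqVneq c 0.
  by rewrite scale0r; apply: fsbig1 => j _; rewrite scale0r.
rewrite scaler_sumr /finite_support !unlock.
rewrite (_ : D `&` _ @^-1` [set~ 0] = D `&` F @^-1` [set~ 0]) //.
apply/seteqP; split=> j /= [Dj Fj]; split=> //.
  by move=> F0; apply: Fj; rewrite F0 scaler0.
by move=> /eqP; rewrite scaler_eq0 (negPf c0) => /eqP.
Qed.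

Lemma smul_theta21 (X : lmodType K) (N : X -> X) x (c : K) (f : mon2 -> K) m :
  smul (fun m => c * f (mswap m)) (sexp (theta21 K) N x) m =
  c *: smul f (sexp (theta12 K) N x) (mswap m).
Proof.
rewrite sexp_swap -[smul f _ _]/((smul f (sexp (theta12 K) N x) \o mswap) m).
rewrite -smul_swap /smul /cauchy -scaler_fsumr.
by apply: eq_fsbigr => pq _; rewrite scalerA.
Qed.

End Swap.

(** * Fields applied to diagonal series *)

Section FieldSeries.
Variable K : numFieldType.

(** A field in z_2 leaves z_1 and zeta_1 alone, and the degree n then fixes the exponent of z_2 in
    the series, so at most one term survives. *)
Lemma sapp_in_z2_dser (X W : nmodType) (f : mon1 -> X -> W) n
    (G : nat -> nat -> X) (m : mon2) : (forall q, f q 0 = 0) ->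
  sapp (in_z2 f) (dser n G) m =
  if 0 <= n - m.1.1
  then f (m.2.1 - (n - m.1.1), m.2.2) (G m.1.2 `|n - m.1.1|%N) else 0.
Proof.
move=> f0; rewrite /sapp.
have H (p q : mon2) : p + q = m -> in_z2 f p (dser n G q) <> 0 ->
    exists j : nat, [/\ j%:Z = n - m.1.1,
      p = ((0, 0%N), (m.2.1 - j%:Z, m.2.2)) & q = (m.1, (j%:Z, 0%N))].
  rewrite /in_z2; case: eqP => //; case: p => p1 p2 /= -> pqm fn.
  have /dser_neq0[j qE] : dser n G q <> 0 by move=> q0; apply: fn; rewrite q0.
  exists j; rewrite -pqm qE; case: q {pqm fn} qE => q1 q2 [q1E q2E] /=.
  split; first by lia.
    by case: p2 => i k /=; rewrite [k + 0]addr0 addrK.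
  by rewrite add0r.
case: ifP => n0; last first.
  apply: contrapT => /cauchy_neq0[p [q [pqm /(H _ _ pqm)[j [jE _ _]]]]].
  by rewrite -jE in n0.
pose d := `|n - m.1.1|%N; have dE : d%:Z = n - m.1.1 by rewrite /d; lia.
pose h (_ : unit) : mon2 * mon2 :=
  (((0, 0%N), (m.2.1 - d%:Z, m.2.2)), (m.1, (d%:Z, 0%N))).
rewrite (cauchy_fin (h := h)).
- rewrite (big_pred1 tt) => [|[]] //=.
  rewrite /in_z2 eqxx /= -dE; congr (f _ _).
  by rewrite (surjective_pairing m.1) dserE // dE; lia.
- by move=> [] [].
- move=> t; rewrite /h /= {t}; case: (m) => [[a b] [e g]] /=.
  by congr ((_, _), (_, _)); rewrite /= ?add0r ?addr0 ?subrK.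
- move=> p q pqm /(H _ _ pqm)[j [jE -> ->]]; exists tt; rewrite /h.
  by have -> : d = j by lia.
Qed.

Lemma sapp2_dser (X W Z : nmodType) (g : mon1 -> W -> Z) (f : mon1 -> X -> W) n
    (G : nat -> nat -> X) (m : mon2) L :
  (forall q, f q 0 = 0) -> (forall q, g q 0 = 0) ->
  (forall r j, (L <= j)%N -> f (m.2.1 - j%:Z, m.2.2) (G r j) = 0) ->
  sapp (in_z1 g) (sapp (in_z2 f) (dser n G)) m =
  \sum_(r < m.1.2.+1) \sum_(j < L)
     g (m.1.1 - n + j%:Z, (m.1.2 - r)%N) (f (m.2.1 - j%:Z, m.2.2) (G r j)).
Proof.
move=> f0 g0 fL; rewrite {1}/sapp.
pose h (t : 'I_m.1.2.+1 * 'I_L) : mon2 * mon2 :=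
  (((m.1.1 - n + (t.2 : nat)%:Z, (m.1.2 - t.1)%N), (0, 0%N)),
   ((n - (t.2 : nat)%:Z, t.1 : nat), m.2)).
rewrite (cauchy_fin (h := h)).
- rewrite pair_bigA; apply: eq_bigr => -[r j] _ /=.
  rewrite /in_z1 eqxx /= sapp_in_z2_dser //= ifT; last by lia.
  by rewrite (_ : n - (n - j%:Z) = j%:Z); last lia.
- move=> [r j] [r' j'] [] _ _ /= nj rr'; congr (_, _); apply: val_inj => //=.
  by lia.
- move=> [r j] /=; have := ltn_ord r; rewrite ltnS => rm.
  rewrite /h /=; move: (nat_of_ord r) (nat_of_ord j) rm => s i.
  case: (m) => [[a b] [e k]] /= rm.
  congr ((_, _), (_, _)); rewrite /= ?add0r //; first by lia.
  by rewrite /GRing.add /= subnK.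
- suff H (p q : mon2) : p + q = m ->
      in_z1 g p (sapp (in_z2 f) (dser n G) q) <> 0 -> exists t, h t = (p, q).
    by move=> p q; exact: H.
  move=> pqm; rewrite /in_z1; case: eqP => //; case: p pqm => [[p1 k] p2] /=.
  move=> pqm p20 gn.
  have m2 : q.2 = m.2 by rewrite -pqm p20 /= add0r.
  move: gn; rewrite sapp_in_z2_dser //; case: ifP => [n0|]; last by rewrite g0.
  pose d := `|n - q.1.1|%N; have dE : d%:Z = n - q.1.1 by rewrite /d; lia.
  rewrite m2 -dE absz_nat => gn.
  have dL : (d < L)%N by rewrite ltnNge; apply/negP => /fL fz; rewrite fz in gn.
  have rm : (q.1.2 < m.1.2.+1)%N by rewrite -pqm /= /GRing.add /=; lia.
  exists (Ordinal rm, Ordinal dL); rewrite /h /= -m2 p20.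
  have -> : n - d%:Z = q.1.1 by lia.
  have -> : (m.1.2 - q.1.2)%N = k by rewrite -pqm /= /GRing.add /=; lia.
  have -> : m.1.1 - n + d%:Z = p1 by rewrite -pqm /= dE; lia.
  by case: q {rm n0 gn m2 dE dL d pqm} => [[? ?] ?].
Qed.

Lemma in_z_swap (X : nmodType) (f : mon1 -> X) :
  (in_z1 f \o mswap = in_z2 f) * (in_z2 f \o mswap = in_z1 f).
Proof. by split; apply/funext => -[? ?]. Qed.

Lemma sapp_swap (X W : nmodType) (A : mon2 -> X -> W) (g : mon2 -> X) m :
  sapp A g m = sapp (A \o mswap) (g \o mswap) (mswap m).
Proof. exact: cauchy_swap. Qed.

Variables (V : superType K) (Y : {bilinear V -> V -> (mon1 -> V)}).

Lemma YIY21_swap F m : YIY21 Y F m = YIY12 Y (F \o mswap) (mswap m).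
Proof.
rewrite /YIY21 sapp_swap !in_z_swap; congr (sapp _ _ _).
by apply/funext => q; rewrite /= sapp_swap mswapK !in_z_swap.
Qed.

End FieldSeries.

(** * The delta function and its derivatives *)

Section Delta.
Variable K : numFieldType.

(* The polynomial sum_(r, s) G r s zeta_1^r zeta_2^s. *)
Definition zser (X : nmodType) (G : nat -> nat -> X) : mon2 -> X :=
  fun m => if (m.1.1 == 0) && (m.2.1 == 0) then G m.1.2 m.2.2 else 0.

Lemma zser_neq0 (X : nmodType) (G : nat -> nat -> X) m :
  zser G m <> 0 -> m = ((0, m.1.2), (0, m.2.2)).
Proof.
case: m => [[i r] [j s]]; rewrite /zser /=.
by case: ifP => // /andP[/eqP-> /eqP->].
Qed.

Lemma zserP (X : nmodType) (G : nat -> nat -> X) (F : mon2 -> X) :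
  (forall m, F m <> 0 -> m = ((0, m.1.2), (0, m.2.2))) ->
  (forall r s, F ((0, r), (0, s)) = G r s) -> F = zser G.
Proof.
move=> F0 FG; apply/funext => m.
have [/F0 ->|/contrapT Fm] := pselect (F m <> 0); first by rewrite FG.
rewrite Fm; have [/zser_neq0 mE|/contrapT //] := pselect (zser G m <> 0).
by move: Fm; rewrite mE FG.
Qed.

Lemma cauchy_zser (A B X : nmodType) (op : A -> B -> X) F G :
  (forall b, op 0 b = 0) -> (forall a, op a 0 = 0) ->
  cauchy op (zser F) (zser G) = zser (fun r s =>
    \sum_(a < r.+1) \sum_(b < s.+1) op (F a b) (G (r - a)%N (s - b)%N)).
Proof.
move=> op0l op0r.
have opn p q : op (zser F p) (zser G q) <> 0 ->
    p = ((0, p.1.2), (0, p.2.2)) /\ q = ((0, q.1.2), (0, q.2.2)).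
  move=> opn; split; [apply: (zser_neq0 (G := F)) | apply: (zser_neq0 (G := G))];
    by move=> z; apply: opn; rewrite z.
apply: zserP => [m /cauchy_neq0[p [q [<- /opn[-> ->]]]] //|r s].
pose h (t : 'I_r.+1 * 'I_s.+1) : mon2 * mon2 :=
  (((0, t.1 : nat), (0, t.2 : nat)), ((0, (r - t.1)%N), (0, (s - t.2)%N))).
rewrite (cauchy_fin (h := h)).
- by rewrite pair_bigA; apply: eq_bigr => -[a b] _.
- by move=> [a b] [a' b'] [] aa' bb' _ _; congr (_, _); apply: val_inj.
- move=> [a b] /=; have := ltn_ord a; have := ltn_ord b; rewrite !ltnS => bs ar.
  by congr ((_, _), (_, _)); rewrite /= /GRing.add /= subnKC.
- suff H (p q : mon2) : p + q = ((0, r), (0, s)) ->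
      op (zser F p) (zser G q) <> 0 -> exists t, h t = (p, q).
    by move=> p q; exact: H.
  move=> pq /opn[pE qE]; move: pq; rewrite pE qE => -[] rE sE.
  have rp : (p.1.2 < r.+1)%N by rewrite -rE /GRing.add /=; lia.
  have sp : (p.2.2 < s.+1)%N by rewrite -sE /GRing.add /=; lia.
  exists (Ordinal rp, Ordinal sp); rewrite /h /=.
  by rewrite -{1}rE -{1}sE /GRing.add /= !addKn.
Qed.

Definition zeta_pow (k r s : nat) : K :=
  if (r + s == k)%N then (-1) ^+ r * k`!%:R / (r`!%:R * s`!%:R) else 0.

Lemma spow_zeta k : spow (zeta2 K - zeta1 K) k = zser (zeta_pow k).
Proof.
have zE : zeta2 K - zeta1 K = zser (fun r s =>
    if (r + s == 1)%N then (-1) ^+ r else 0).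
  apply: zserP => [m|r s].
    rewrite /zeta2 /zeta1 /monom !fctE; do 2 case: eqP => [->|_] //.
    by rewrite subrr.
  rewrite /zeta2 /zeta1 /monom !fctE !xpair_eqE.
  by case: r s => [|[|r]] [|[|s]] //=; rewrite ?subr0 ?sub0r.
elim: k => [|k IH].
  rewrite -[LHS]/(monom K 0) /monom; apply: zserP => [m|r s].
    by case: eqP => // ->.
  rewrite !xpair_eqE /zeta_pow addn_eq0 /=.
  by case: r s => [|r] [|s] //=; rewrite expr0 fact0 !mul1r invr1.
rewrite -[spow _ _.+1]/(cauchy *%R (zeta2 K - zeta1 K) (spow (zeta2 K - zeta1 K) k)).
rewrite IH zE cauchy_zser; [|exact: mul0r|exact: mulr0].
congr zser; apply/funext => r; apply/funext => s.
have first_term : \sum_(b < s.+1) (if (0 + b == 1)%N then (-1) ^+ 0 else 0)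
    * zeta_pow k (r - 0) (s - b) = if s is s'.+1 then zeta_pow k r s' else 0.
  case: s => [|s]; first by rewrite big_ord1 mul0r.
  rewrite big_ord_recl big_ord_recl /= mul0r add0r mul1r big1 ?addr0.
    by rewrite subn0 subSS subn0.
  by move=> i _; rewrite mul0r.
have second_term : \sum_(a < r) \sum_(b < s.+1)
    (if (lift ord0 a + b == 1)%N then (-1) ^+ (lift ord0 a) else 0) *
    zeta_pow k (r - lift ord0 a) (s - b) = if r is r'.+1 then - zeta_pow k r' s else 0.
  case: r {first_term} => [|r]; first by rewrite big_ord0.
  rewrite big_ord_recl [X in _ + X]big1 ?addr0 => [|a _]; last first.
    by apply: big1 => b _; rewrite !lift0 mul0r.
  rewrite big_ord_recl big1 ?addr0 => [|b _]; last by rewrite !lift0 mul0r.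
  by rewrite lift0 /= expr1 mulN1r subSS !subn0.
rewrite big_ord_recl first_term second_term /zeta_pow.
case: r s {first_term second_term} => [|r] [|s].
- by rewrite addr0.
- rewrite addr0 !add0n eqSS; case: eqP => // ->; rewrite !fact0 !mul1r.
  by rewrite !divff ?fact_neq0.
- rewrite add0r !addn0 eqSS; case: eqP => [->|]; rewrite ?oppr0 //.
  by rewrite fact0 !mulr1 !mulfK ?fact_neq0 // exprS mulN1r.
- rewrite !addSn !addnS eqSS; case: eqP => [<-|]; rewrite ?subr0 //.
  rewrite exprS (_ : (r + s).+2`! = (r + s).+2 * (r + s).+1`!)%N //.
  move: ((r + s).+1`!) => e; rewrite !factS !natrM.
  (* What remains is Pascal's rule, written with factorials. *)
  have -> : (r + s).+2%:R = r.+1%:R + s.+1%:R :> K by rewrite -natrD addnS addSn.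
  have := fact_neq0 K r; have := fact_neq0 K s; have := nat_neq0 K r.
  have := nat_neq0 K s.
  move: (r`!%:R) (s`!%:R) (r.+1%:R) (s.+1%:R) (e%:R) ((-1) ^+ r).
  by move=> a b c d {}e f d0 c0 b0 a0; field; rewrite a0 b0 c0 d0.
Qed.

Variables (X : lmodType K) (N : {linear X -> X}).

Lemma iter_neg k (x : X) : iter k (\- N) x = (-1) ^+ k *: iter k N x.
Proof.
elim: k => [|k IH] /=; first by rewrite scale1r.
by rewrite IH linearZ /= -scaleN1r scalerA exprS.
Qed.

Lemma sexp_zeta x : (exists Q, iter Q N x = 0) ->
  sexp (zeta2 K - zeta1 K) N x = zser (fun r s => eop s N (eop r (\- N) x)).
Proof.
move=> [Q Qx].
have E m : sexp (zeta2 K - zeta1 K) N x m =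
    \sum_(k < Q) (zser (zeta_pow k) m / k`!%:R) *: iter k N x.
  rewrite /sexp /formal_sum (fsbig_nat (L := Q)) => [|k Qk]; last first.
    by rewrite (iter_nilp Qx) // scaler0.
  by apply: eq_bigr => k _; rewrite spow_zeta.
apply: zserP => [m|r s]; rewrite E.
  move=> s0; apply: contrapT => none; apply: s0; apply: big1 => k _.
  have [/zser_neq0 //|/contrapT ->] := pselect (zser (zeta_pow k) m <> 0).
  by rewrite mul0r scale0r.
rewrite /eop iter_neg scalerA [iter s N _]linearZ /= -iterD addnC scalerA.
have [rsQ|Qrs] := ltnP (r + s) Q.
  rewrite (bigD1 (Ordinal rsQ)) //= big1 ?addr0 => [|k]; last first.
    rewrite -val_eqE /= /zser /= /zeta_pow eq_sym => /negPf ->.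
    by rewrite mul0r scale0r.
  rewrite /zser /= /zeta_pow eqxx; congr (_ *: _).
  by rewrite mulrAC mulfK ?fact_neq0 // invfM; ring.
rewrite (iter_nilp Qx) // scaler0 big1 // => k _.
by rewrite /zser /= /zeta_pow gtn_eqF ?mul0r ?scale0r // (leq_trans _ Qrs).
Qed.

Lemma deltaE m : delta K m =
  ([&& m.1.2 == 0%N, m.2.2 == 0%N & m.1.1 + m.2.1 == -1])%:R.
Proof.
case: m => [[i r] [j s]] /=; rewrite /delta /formal_sum.
rewrite (fsbigE [:: j]) //=.
  rewrite big_cons big_nil in_setT addr0 zzE !xpair_eqE eqxx /=.
  by congr ((_ : bool)%:R); lia.
move=> k _; rewrite inE zzE !xpair_eqE => /negPf kj.
by rewrite [j == k]eq_sym kj andbF.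
Qed.

Lemma deltaN_eq x (m : mon2) : (exists Q, iter Q N x = 0) ->
  deltaN N x m = if m.1.1 + m.2.1 == -1
    then eop m.2.2 N (eop m.1.2 (\- N) x) else 0.
Proof.
move=> nilx; rewrite /deltaN sexp_zeta // /smul.
set G := fun r s : nat => _.
have H (p q : mon2) : p + q = m -> delta K p *: zser G q <> 0 ->
    m.1.1 + m.2.1 = -1 /\
    (p, q) = (((m.1.1, 0%N), (m.2.1, 0%N)), ((0, m.1.2), (0, m.2.2))).
  move=> <- dz; have /zser_neq0 qE : zser G q <> 0.
    by move=> q0; apply: dz; rewrite q0 scaler0.
  move: dz; rewrite deltaE; case: and3P => [|_]; last by rewrite scale0r.
  move=> [/eqP p12 /eqP p22 /eqP p11] _; rewrite qE /= !addr0; split=> //.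
  case: p p12 p22 {p11} => [[i r] [j s]] /= -> ->.
  by congr ((_, _), ((_, _), (_, _))); rewrite /= add0r.
case: eqP => [m1|m1]; last first.
  by apply: contrapT => /cauchy_neq0[p [q [/H pq /pq[]]]].
pose h (_ : unit) : mon2 * mon2 :=
  (((m.1.1, 0%N), (m.2.1, 0%N)), ((0, m.1.2), (0, m.2.2))).
rewrite (cauchy_fin (h := h)).
- by rewrite (big_pred1 tt) => [|[]] //=; rewrite deltaE /= m1 scale1r.
- by move=> [] [].
- move=> t; rewrite /h /= {t}; case: (m) => [[i r] [j s]] /=.
  by congr ((_, _), (_, _)); rewrite /= ?addr0 ?add0r.
- by move=> p q /H pqm /pqm[_ pqE]; exists tt.
Qed.

(** On z_2^l e^(zeta_2 N) the derivation D_(z_2) multiplies by (l + N)/z_2. The coefficient at z_2^l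
    after j steps starts from z_2^(l + j), and the factors l + j + N, ..., l + 1 + N over j! form
    binomial(l + j + N, j). *)
Lemma Dz2_div_deltaN x j (m : mon2) : (exists Q, iter Q N x = 0) ->
  Dz2_div j (deltaN N x) m = if m.1.1 + m.2.1 == - j.+1%:Z
    then bop (m.2.1 + j%:Z) N j (eop m.2.2 N (eop m.1.2 (\- N) x)) else 0.
Proof.
move=> nilx; elim: j m => [|j IH] m.
  by rewrite /Dz2_div fact0 invr1 scale1r /= deltaN_eq // addr0.
case: m => [[i r] [l s]] /=.
have -> : Dz2_div j.+1 (deltaN N x) ((i, r), (l, s)) = j.+1%:R^-1 *:
   ((l + 1)%:~R *: Dz2_div j (deltaN N x) ((i, r), (l + 1, s)) +
    s.+1%:R *: Dz2_div j (deltaN N x) ((i, r), (l + 1, s.+1))).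
  rewrite /Dz2_div factS natrM invfM -!scalerA; congr (_ *: _).
  rewrite [_ *: (j`!%:R^-1 *: _)]scalerA [_ * j`!%:R^-1]mulrC -scalerA.
  rewrite [s.+1%:R *: (j`!%:R^-1 *: _)]scalerA [_ * j`!%:R^-1]mulrC -scalerA.
  by rewrite -scalerDr.
rewrite !IH /= (_ : (i + (l + 1) == - j.+1%:Z) = (i + l == - j.+2%:Z)); last by lia.
case: ifP => _; last by rewrite !scaler0 addr0 scaler0.
apply: (scalerI_nat (n := j)); rewrite scalerA divff ?nat_neq0 // scale1r.
rewrite (_ : l + j.+1%:Z = l + 1 + j%:Z); last by lia.
rewrite -[RHS]/(j.+1%:R *: bop _ N j.+1 _) bopS addrK; congr (_ + _).
rewrite (bop_intertwine (M := N) (N := N) (g := N)) //.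
by rewrite -[LHS]linearZ eopS.
Qed.

End Delta.

(** * Parity and permutations of tensor factors *)

Arguments tmap : simpl never.
Arguments tassoc : simpl never.
Arguments tassocV : simpl never.
Arguments op12 : simpl never.
Arguments op13 : simpl never.
Arguments op23 : simpl never.
Arguments flip : simpl never.
Arguments Yz : simpl never.
Arguments IYz : simpl never.
Arguments mu : simpl never.

Section TensorMaps.
Variables (K : numFieldType) (V : superType K).

Lemma tensl_is_linear (U W : lmodType K) (w : W) : linear (fun t : U => t ⊗ w).
Proof. by move=> k x y; rewrite linearPl. Qed.
(** Tensoring with a fixed vector, named as a linear map so that extensionality on pure tensors
    applies one factor at a time. *)
Definition tensl (U W : lmodType K) (w : W) (t : U) : tensor U W := t ⊗ w.
HB.instance Definition _ (U W : lmodType K) (w : W) :=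
  GRing.isLinear.Build K U (tensor U W) *:%R (@tensl U W w) (tensl_is_linear w).

Lemma tensr_is_linear (U W : lmodType K) (u : U) : linear (fun t : W => u ⊗ t).
Proof. by move=> k x y; rewrite linearPr. Qed.
Definition tensr (U W : lmodType K) (u : U) (t : W) : tensor U W := u ⊗ t.
HB.instance Definition _ (U W : lmodType K) (u : U) :=
  GRing.isLinear.Build K W (tensor U W) *:%R (@tensr U W u) (tensr_is_linear u).

Lemma tensZl (U W : lmodType K) k (u : U) (w : W) : (k *: u) ⊗ w = k *: (u ⊗ w).
Proof. exact: linearZZ (tensl w) k u. Qed.
Lemma tensZr (U W : lmodType K) k (u : U) (w : W) : u ⊗ (k *: w) = k *: (u ⊗ w).
Proof. exact: linearZZ (tensr u) k w. Qed.

Lemma tens0l (U W : lmodType K) (w : W) : (0 : U) ⊗ w = 0.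
Proof. exact: linear0 (tensl w). Qed.
Lemma tens0r (U W : lmodType K) (u : U) : u ⊗ (0 : W) = 0.
Proof. exact: linear0 (tensr u). Qed.

Lemma tmap_tens (U W U' W' : lmodType K) (f : {linear U -> U'})
    (g : {linear W -> W'}) u w : tmap f g (u ⊗ w) = f u ⊗ g w.
Proof. exact: bilift_tens. Qed.

Lemma tassocK (U W X : lmodType K) : cancel (tassoc U W X) (tassocV U W X).
Proof.
move=> x; apply: (tens_ext (f := tassocV U W X \o tassoc U W X) (g := idfun)) => t w.
apply: (tens_ext (f := (tassocV U W X \o tassoc U W X) \o tensl w) (g := tensl w)).
by move=> u v; rewrite /= /tensl tassoc_tens tassocV_tens.
Qed.

Lemma tassocVK (U W X : lmodType K) : cancel (tassocV U W X) (tassoc U W X).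
Proof.
move=> x; apply: (tens_ext (f := tassoc U W X \o tassocV U W X) (g := idfun)) => u t.
apply: (tens_ext (f := (tassoc U W X \o tassocV U W X) \o tensr u) (g := tensr u)).
by move=> w v; rewrite /= /tensr tassocV_tens tassoc_tens.
Qed.

Lemma tens3_ext (X : lmodType K) (f g : {linear tensor3 V -> X}) :
  (forall a b c, f (a ⊗ b ⊗ c) = g (a ⊗ b ⊗ c)) -> f =1 g.
Proof.
move=> fg; apply: tens_ext => t c.
by apply: (tens_ext (f := f \o tensl c) (g := g \o tensl c)) => a b; exact: fg.
Qed.

Lemma op12_tens f (t : tensor V V) (c : V) : op12 f (t ⊗ c) = f t ⊗ c.
Proof. exact: tmap_tens. Qed.

Lemma op23_tens f (a : V) (t : tensor V V) :
  op23 f (tassocV V V V (a ⊗ t)) = tassocV V V V (a ⊗ f t).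
Proof.
rewrite -[LHS]/(tassocV V V V (tmap idfun f (tassoc V V V (tassocV V V V (a ⊗ t))))).
by rewrite tassocVK tmap_tens.
Qed.

Lemma op23_tens3 f (a b c : V) :
  op23 f (a ⊗ b ⊗ c) = tassocV V V V (a ⊗ f (b ⊗ c)).
Proof. by rewrite -tassocV_tens op23_tens. Qed.

End TensorMaps.

(** The parity involution v -> (-1)^p(v) v. A vector crossed by an odd one undergoes it, which
    expresses Koszul signs without splitting the crossed vector into its parts. *)
Definition psign {K : numFieldType} {V : superType K} (v : V) : V :=
  part false v - part true v.

Lemma psign_is_linear (K : numFieldType) (V : superType K) : linear (@psign K V).
Proof. exact: (linearP (part false \- part true)). Qed.
HB.instance Definition _ (K : numFieldType) (V : superType K) :=
  GRing.isLinear.Build K V V *:%R (@psign K V) (@psign_is_linear K V).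

Definition psign2 {K : numFieldType} {V : superType K}
  (t : tensor V V) : tensor V V := tmap psign psign t.
HB.instance Definition _ (K : numFieldType) (V : superType K) :=
  GRing.Linear.copy (@psign2 K V) (tmap psign psign).

Arguments psign : simpl never.
Arguments psign2 : simpl never.

Section Parity.
Variables (K : numFieldType) (V : superType K).

Lemma part_parity p (v : V) : has_parity p (part p v).
Proof. by rewrite /has_parity part_part eqxx. Qed.

Lemma homog_ext (X : lmodType K) (f g : {linear V -> X}) :
  (forall p v, has_parity p v -> f v = g v) -> f =1 g.
Proof.
move=> fg v; rewrite -(part_sum v) !linearD /=.
by congr (_ + _); apply: fg (part_parity _ _).
Qed.

Lemma homog_tens_ext (X : lmodType K) (f g : {linear tensor V V -> X}) :
  (forall p q a b, has_parity p a -> has_parity q b ->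
     f (a ⊗ b) = g (a ⊗ b)) -> f =1 g.
Proof.
move=> fg; apply: tens_ext => a b.
apply: (homog_ext (f := f \o tensl b) (g := g \o tensl b)) => p {}a pa.
apply: (homog_ext (f := f \o tensr a) (g := g \o tensr a)) => q {}b qb.
exact: fg pa qb.
Qed.

Lemma psign_homog p (v : V) : has_parity p v -> psign v = (-1) ^+ p *: v.
Proof.
move=> pv; rewrite -[psign v]/(part false v - part true v) !(part_homog _ pv).
by case: p pv => _ /=; rewrite ?sub0r ?subr0 ?expr1 ?scaleN1r ?scale1r.
Qed.

Lemma flip_homog p q (a b : V) : has_parity p a -> has_parity q b ->
  flip V (a ⊗ b) = (-1) ^+ (p && q) *: (b ⊗ a).
Proof.
move=> pa qb; rewrite /flip bilift_tens (koszul_homog _ _ pa qb) // => c.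
- exact: tens0r.
- exact: tens0l.
Qed.

Lemma flip_tensr e (u c : V) : has_parity e c ->
  flip V (u ⊗ c) = c ⊗ iter e psign u.
Proof.
move=> ec; apply: (homog_ext (f := flip V \o tensl c)
  (g := tensr c \o iter e psign)) => p {}u pu.
rewrite /= /tensl /tensr (flip_homog pu ec).
case: e ec => ec /=; rewrite ?andbF ?andbT ?scale1r //.
by rewrite (psign_homog pu) tensZr.
Qed.

Lemma flipK : involutive (flip V).
Proof.
apply: (homog_tens_ext (f := flip V \o flip V) (g := idfun)) => p q a b pa qb /=.
rewrite (flip_homog pa qb) linearZ /= (flip_homog qb pa) scalerA andbC.
by rewrite -expr2 sqrr_sign scale1r.
Qed.

Lemma P12K : involutive (op12 (flip V)).
Proof.
apply: (tens_ext (f := op12 (flip V) \o op12 (flip V)) (g := idfun)) => t c.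
by rewrite /= !op12_tens flipK.
Qed.

Lemma P23K : involutive (op23 (flip V)).
Proof.
apply: (tens3_ext (f := op23 (flip V) \o op23 (flip V)) (g := idfun)) => a b c.
rewrite -[LHS]/(op23 (flip V) (op23 (flip V) (a ⊗ b ⊗ c))).
by rewrite op23_tens3 op23_tens flipK tassocV_tens.
Qed.

(* P12 P23 moves the last tensor factor in front of the first two. *)
Lemma cycle_tens e (t : tensor V V) (c : V) : has_parity e c ->
  op12 (flip V) (op23 (flip V) (t ⊗ c)) = tassocV V V V (c ⊗ iter e psign2 t).
Proof.
move=> ec; apply: (homog_tens_ext (f := (op12 (flip V) \o op23 (flip V)) \o tensl c)
  (g := tassocV V V V \o (tensr c \o iter e psign2))) => p q a b pa qb.
rewrite -[LHS]/(op12 (flip V) (op23 (flip V) (a ⊗ b ⊗ c))).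
rewrite -[RHS]/(tassocV V V V (c ⊗ iter e psign2 (a ⊗ b))).
rewrite op23_tens3 (flip_homog qb ec).
rewrite tensZr 2!linearZ /= tassocV_tens op12_tens (flip_homog pa ec).
rewrite tensZl scalerA.
case: e ec => ec /=; rewrite ?andbF ?andbT ?mul1r ?scale1r ?tassocV_tens //.
rewrite /psign2 tmap_tens /= (psign_homog pa) (psign_homog qb).
by rewrite tensZl !tensZr scalerA linearZ /= tassocV_tens mulrC.
Qed.

Lemma psign_homog_map q (f : {linear V -> V}) v : homog_map q f ->
  psign (f v) = (-1) ^+ q *: f (psign v).
Proof.
move=> fq; apply: (homog_ext (f := psign \o f)
  (g := ( *:%R ((-1) ^+ q)) \o (f \o psign))) => p {}v pv /=.
rewrite (psign_homog (fq _ _ pv)) (psign_homog pv) linearZ /= scalerA.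
by rewrite -signr_addb addbC.
Qed.

(** In each summand f ⊗ g both maps have the same parity q, and their two signs (-1)^q cancel. *)
Lemma even_End2_psign (S : {linear tensor V V -> tensor V V}) t :
  even_End2 S -> S (psign2 t) = psign2 (S t).
Proof.
move=> [n [q [f [g [fg SE]]]]]; rewrite !SE linear_sum; apply: eq_bigr => i _.
have [fi gi] := fg i.
apply: (tens_ext (f := stmap (q i) (f i) (g i) \o psign2)
  (g := psign2 \o stmap (q i) (f i) (g i))) => {t} a b /=.
rewrite /psign2 tmap_tens /stmap !bilift_tens linear_sum; apply: eq_bigr => p _.
rewrite linearZ /= tmap_tens; congr (_ *: _).
rewrite /= (psign_homog_map _ fi) (psign_homog_map _ gi) tensZl tensZr scalerA.
rewrite -expr2 sqrr_sign scale1r; congr (f i _ ⊗ _).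
rewrite (psign_homog (part_parity p a)) /psign linearB /= !part_part.
by case: p; rewrite /= ?sub0r ?subr0 ?scaleN1r ?scale1r.
Qed.

End Parity.

(* yz m, iy m and yi m are the coefficients at m of Y(z), I ⊗ Y(z) and
   Y(z) ⊗ I; below, md n, im n and mi n are the operators mu_(n), I ⊗ mu_(n)
   and mu_(n) ⊗ I. *)
Section LogVAOperators.
Context {K : numFieldType} {V : superType K} (A : logVA V).

Definition s12 (x : tensor3 V) : tensor3 V := op12 (braid A) x.
Definition s13 (x : tensor3 V) : tensor3 V := op13 (braid A) x.
Definition s23 (x : tensor3 V) : tensor3 V := op23 (braid A) x.
Definition yz (m : mon1) (t : tensor V V) : V := Yz (Y A) m t.
Definition iy (m : mon1) (x : tensor3 V) : tensor V V := IYz (Y A) m x.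
Definition yi (m : mon1) (x : tensor3 V) : tensor V V := tmap (Yz (Y A) m) idfun x.

HB.instance Definition _ := GRing.Linear.copy s12 (op12 (braid A)).
HB.instance Definition _ := GRing.Linear.copy s13 (op13 (braid A)).
HB.instance Definition _ := GRing.Linear.copy s23 (op23 (braid A)).
HB.instance Definition _ m := GRing.Linear.copy (yz m) (Yz (Y A) m).
HB.instance Definition _ m := GRing.Linear.copy (iy m) (IYz (Y A) m).
HB.instance Definition _ m := GRing.Linear.copy (yi m) (tmap (Yz (Y A) m) idfun).

End LogVAOperators.

Section Permutations.
Context {K : numFieldType} {V : superType K}.

Definition p12 (x : tensor3 V) : tensor3 V := op12 (flip V) x.
Definition p23 (x : tensor3 V) : tensor3 V := op23 (flip V) x.

HB.instance Definition _ := GRing.Linear.copy p12 (op12 (flip V)).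
HB.instance Definition _ := GRing.Linear.copy p23 (op23 (flip V)).

End Permutations.

Arguments s12 : simpl never.
Arguments s13 : simpl never.
Arguments s23 : simpl never.
Arguments yz : simpl never.
Arguments iy : simpl never.
Arguments yi : simpl never.
Arguments p12 : simpl never.
Arguments p23 : simpl never.

(** * Hexagon identities, the vacuum, and truncation bounds *)

Section LogVABasics.
Context {K : numFieldType} {V : superType K} (A : logVA V).
Local Notation S := (braid A).
Local Notation s12 := (s12 A).
Local Notation s13 := (s13 A).
Local Notation s23 := (s23 A).
Local Notation yz := (yz A).
Local Notation iy := (iy A).
Local Notation yi := (yi A).
Local Notation p12 := (@p12 K V).
Local Notation p23 := (@p23 K V).
Local Notation tV := (tassocV V V V).

Lemma s12E t c : s12 (t ⊗ c) = S t ⊗ c.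
Proof. exact: op12_tens. Qed.
Lemma s23E a t : s23 (tV (a ⊗ t)) = tV (a ⊗ S t).
Proof. exact: op23_tens. Qed.
Lemma p12E t c : p12 (t ⊗ c) = flip V t ⊗ c.
Proof. exact: op12_tens. Qed.
Lemma p23E a t : p23 (tV (a ⊗ t)) = tV (a ⊗ flip V t).
Proof. exact: op23_tens. Qed.
Lemma yiE m t c : yi m (t ⊗ c) = yz m t ⊗ c.
Proof. exact: tmap_tens. Qed.
Lemma iyE m a t : iy m (tV (a ⊗ t)) = a ⊗ yz m t.
Proof.
rewrite -[LHS]/(tmap idfun (Yz (Y A) m) (tassoc V V V (tV (a ⊗ t)))).
by rewrite tassocVK tmap_tens.
Qed.
Lemma yzE m a b : yz m (a ⊗ b) = Y A a b m.
Proof. exact: bilift_tens. Qed.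

Lemma p12K : involutive p12. Proof. exact: P12K. Qed.
Lemma p23K : involutive p23. Proof. exact: P23K. Qed.

Lemma s13_def x : s13 x = p23 (s12 (p23 x)).
Proof. by []. Qed.

Lemma s12s23C x : s12 (s23 x) = s23 (s12 x).
Proof. by have [_ _ H _ _] := braidP A; exact: H. Qed.
Lemma s13s23C x : s13 (s23 x) = s23 (s13 x).
Proof. by have [_ _ _ H _] := braidP A; exact: H. Qed.
Lemma s12s13C x : s12 (s13 x) = s13 (s12 x).
Proof. by have [_ _ _ _ H] := braidP A; exact: H. Qed.

Lemma S_flip t : S (flip V t) = flip V (S t).
Proof. by have [_ H _ _ _] := braidP A; exact: H. Qed.

Lemma S_psign2 t : S (psign2 t) = psign2 (S t).
Proof. by have [H _ _ _ _] := braidP A; exact: even_End2_psign. Qed.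

Lemma last_homog_ext (X : lmodType K) (f g : {linear tensor3 V -> X}) :
  (forall e t c, has_parity e c -> f (t ⊗ c) = g (t ⊗ c)) -> f =1 g.
Proof.
move=> fg; apply: tens_ext => t c.
apply: (homog_ext (f := f \o tensr t) (g := g \o tensr t)) => e {}c ec.
exact: fg ec.
Qed.

Lemma cycleE e t c : has_parity e c ->
  p12 (p23 (t ⊗ c)) = tV (c ⊗ iter e psign2 t).
Proof. exact: cycle_tens. Qed.

(* Naturality of the braiding of superspaces, since S is even. *)
Lemma s23_cycle x : s23 (p12 (p23 x)) = p12 (p23 (s12 x)).
Proof.
apply: (last_homog_ext (f := s23 \o (p12 \o p23)) (g := p12 \o (p23 \o s12))).
move=> e t c ec /=; rewrite (cycleE _ ec) s23E s12E (cycleE _ ec).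
by case: e ec => //= _; rewrite S_psign2.
Qed.

Lemma p12_s12 x : p12 (s12 x) = s12 (p12 x).
Proof.
apply: (tens_ext (f := p12 \o s12) (g := s12 \o p12)) => t c /=.
by rewrite s12E !p12E s12E S_flip.
Qed.

Lemma p23_s23 x : p23 (s23 x) = s23 (p23 x).
Proof.
rewrite -[x](tassocK (U := V)); move: (tassoc V V V x) => {}x.
apply: (tens_ext (f := p23 \o (s23 \o tV)) (g := s23 \o (p23 \o tV))) => a t /=.
by rewrite !(s23E, p23E) S_flip.
Qed.

Lemma p23_s13 x : p23 (s13 x) = s12 (p23 x).
Proof. by rewrite s13_def p23K. Qed.
Lemma p12_s13 x : p12 (s13 x) = s23 (p12 x).
Proof. by rewrite s13_def -s23_cycle p23K. Qed.
Lemma p12_s23 x : p12 (s23 x) = s13 (p12 x).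
Proof. by rewrite -[s23 x](_ : p12 (s13 (p12 x)) = _) ?p12K // p12_s13 p12K. Qed.

Lemma psign_yz m t : psign (yz m t) = yz m (psign2 t).
Proof.
apply: (homog_tens_ext (f := psign \o yz m) (g := yz m \o psign2)) => p q a b pa qb /=.
rewrite /psign2 tmap_tens /= (psign_homog pa) (psign_homog qb) tensZl tensZr.
rewrite scalerA linearZ /= yzE (psign_homog (Y_even A m pa qb)).
by rewrite signr_addb.
Qed.

(** Conjugation by permutations turns Y(z) ⊗ I into I ⊗ Y(z); Y is even, so [psign] passes through
    it. *)
Lemma flip_yi m x : flip V (yi m x) = iy m (p12 (p23 x)).
Proof.
apply: (last_homog_ext (f := flip V \o yi m) (g := iy m \o (p12 \o p23))).
move=> e t c ec /=; rewrite yiE (flip_tensr _ ec) (cycleE _ ec) iyE.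
by case: e ec => //= _; rewrite psign_yz.
Qed.

Lemma S_yi m x : S (yi m x) = yi m (s13 x + s23 x).
Proof. exact: hexagon. Qed.

(** The mirror image of the hexagon identity, carried over by [flip], with which S commutes. *)
Lemma S_iy m x : S (iy m x) = iy m (s12 x + s13 x).
Proof.
rewrite -[x]p12K -[p12 x]p23K; set y := p23 (p12 x).
rewrite -flip_yi S_flip S_yi flip_yi; congr (iy m _).
by rewrite !linearD /= p23_s13 p12_s12 p23_s23 p12_s23.
Qed.

Lemma flip_vacr b : flip V (b ⊗ vac A) = vac A ⊗ b.
Proof. exact: (flip_tensr _ (vac_even A)). Qed.

Lemma flip_vacl b : flip V (vac A ⊗ b) = b ⊗ vac A.
Proof. by rewrite -flip_vacr flipK. Qed.

Lemma p23_vac a c : p23 (a ⊗ vac A ⊗ c) = a ⊗ c ⊗ vac A.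
Proof. by rewrite -tassocV_tens p23E flip_vacl tassocV_tens. Qed.

Lemma s13_vac a c : s13 (a ⊗ vac A ⊗ c) = p23 (S (a ⊗ c) ⊗ vac A).
Proof. by rewrite s13_def p23_vac s12E. Qed.

Lemma p23_vacr a b : p23 (a ⊗ b ⊗ vac A) = a ⊗ vac A ⊗ b.
Proof. by rewrite -p23_vac p23K. Qed.

(* The hexagon identity at 1 ⊗ 1 ⊗ c reads s = s + s for s = S(1 ⊗ c). *)
Lemma S_vacl c : S (vac A ⊗ c) = 0.
Proof.
have yiv t : yi (0, 0%N) (tV (vac A ⊗ t)) = t.
  apply: (tens_ext (f := yi (0, 0%N) \o (tV \o tensr (vac A))) (g := idfun)) => u v.
  by rewrite /= /tensr tassocV_tens yiE yzE Y_vacl.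
have yvi t : yi (0, 0%N) (p23 (t ⊗ vac A)) = t.
  apply: (tens_ext (f := yi (0, 0%N) \o (p23 \o tensl (vac A))) (g := idfun)) => u v.
  by rewrite /= /tensl p23_vacr yiE yzE Y_vacr0.
have := S_yi (0, 0%N) (vac A ⊗ vac A ⊗ c).
rewrite yiE yzE Y_vacl eqxx linearD /= s13_vac yvi.
rewrite -[X in s23 X]tassocV_tens s23E yiv => /eqP.
by rewrite -subr_eq subrr => /eqP.
Qed.

Lemma S_vacr a : S (a ⊗ vac A) = 0.
Proof. by rewrite -flip_vacl S_flip S_vacl linear0. Qed.

Lemma nilp_sum (X : lmodType K) (N : {linear X -> X}) (I : Type) (r : seq I)
    (F : I -> X) : (forall i, exists Q, iter Q N (F i) = 0) ->
  exists Q, iter Q N (\sum_(i <- r) F i) = 0.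
Proof.
move=> nilF; elim: r => [|i r [Q IH]]; first by exists 0%N; rewrite big_nil.
have [Q' Qi] := nilF i; exists (Q + Q')%N.
rewrite big_cons linearD /= (iter_nilp Qi) ?leq_addl //.
by rewrite (iter_nilp IH) ?leq_addr ?addr0.
Qed.

Lemma s12_nilp x : exists Q, iter Q s12 x = 0.
Proof.
rewrite (tens_sum x); apply: nilp_sum => -[t c] /=.
have [Q Qt] := braid_nilpotent A t; exists Q.
have -> : iter Q s12 (t ⊗ c) = iter Q S t ⊗ c.
  by elim: Q {Qt} => //= Q ->; rewrite s12E.
by rewrite Qt tens0l.
Qed.

Lemma s13_nilp x : exists Q, iter Q s13 x = 0.
Proof.
have [Q Qx] := s12_nilp (p23 x); exists Q; apply: (can_inj p23K).
by rewrite (iter_intertwine p23_s13) Qx linear0.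
Qed.

Definition bounded (X W : lmodType K) (f : int -> {linear X -> W}) (x : X) : Prop :=
  exists B : nat, forall i : int, B%:Z <= - i -> f i x = 0.

Lemma bounded_sum (X W : lmodType K) (f : int -> {linear X -> W}) (I : Type)
    (r : seq I) (F : I -> X) :
  (forall i, bounded f (F i)) -> bounded f (\sum_(i <- r) F i).
Proof.
move=> bF; elim: r => [|i r [B IH]].
  by exists 0%N => i _; rewrite big_nil linear0.
have [B' Bi] := bF i; exists (B + B')%N => j jB.
by rewrite big_cons linearD /= Bi ?IH ?addr0 //; lia.
Qed.

Lemma yz_bounded k (t : tensor V V) : bounded (fun i => yz (i, k)) t.
Proof.
rewrite (tens_sum t); apply: bounded_sum => -[a b] /=.
have [_ /(_ k)[N YN]] := Y_laurent_log A a b.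
by exists (`|N|%N).+1 => i iN; rewrite /= yzE YN //; lia.
Qed.

Lemma yi_bounded k (x : tensor3 V) : bounded (fun i => yi (i, k)) x.
Proof.
rewrite (tens_sum x); apply: bounded_sum => -[t c] /=.
have [B BP] := yz_bounded k t; exists B => i /BP ti.
by rewrite /= yiE ti tens0l.
Qed.

Lemma iy_bounded k (x : tensor3 V) : bounded (fun i => iy (i, k)) x.
Proof.
rewrite -[x](tassocK (U := V)) (tens_sum (tassoc V V V x)) linear_sum.
apply: bounded_sum => -[a t] /=.
have [B BP] := yz_bounded k t; exists B => i /BP ti.
by rewrite /= iyE ti tens0r.
Qed.

(** Nilpotence makes the orbit of x finite up to zeros, so one bound serves it all, and with it
    every polynomial in N applied to x. *)
Lemma bounded_orbit (X W : lmodType K) (f : int -> {linear X -> W})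
    (N : {linear X -> X}) x : (forall y, bounded f y) ->
  (exists Q, iter Q N x = 0) ->
  exists B : nat, forall i : int, B%:Z <= - i -> forall k, f i (iter k N x) = 0.
Proof.
move=> bf [Q Qx].
suff [B BP] : exists B : nat, forall i : int, B%:Z <= - i ->
    forall k, (k < Q)%N -> f i (iter k N x) = 0.
  exists B => i iB k; have [/BP|Qk] := ltnP k Q; first exact.
  by rewrite (iter_nilp Qx) // linear0.
elim: Q {Qx} => [|Q [B IH]]; first by exists 0%N.
have [B' BP] := bf (iter Q N x); exists (B + B')%N => i iB k.
rewrite ltnS leq_eqVlt => /predU1P[->|kQ]; first by apply: BP; lia.
by apply: IH => //; lia.
Qed.

End LogVABasics.

(** * Logarithmic part and translation *)

Section ModeExpansion.
Context {K : numFieldType} {V : superType K} (A : logVA V).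
Local Notation S := (braid A).
Local Notation s12 := (s12 A).
Local Notation yz := (yz A).
Local Notation iy := (iy A).
Local Notation p12 := (@p12 K V).

Lemma fsbig_linear (X W : lmodType K) (F : nat -> {linear X -> W}) :
  (forall x, exists L, forall j, (L <= j)%N -> F j x = 0) ->
  linear (fun x => \sum_(j \in [set: nat]) F j x).
Proof.
move=> F0 k x y; have [L1 x0] := F0 x; have [L2 y0] := F0 y.
have LP z : (forall j, (L1 + L2 <= j)%N -> F j z = 0) ->
    \sum_(j \in [set: nat]) F j z = \sum_(j < L1 + L2) F j z.
  by move=> z0; apply: fsbig_nat.
have x0' j : (L1 + L2 <= j)%N -> F j x = 0 by move=> jL; apply: x0; lia.
have y0' j : (L1 + L2 <= j)%N -> F j y = 0 by move=> jL; apply: y0; lia.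
rewrite !LP // => [|j jL]; last by rewrite linearP x0' // y0' // scaler0 addr0.
by rewrite scaler_sumr -big_split; apply: eq_bigr => j _; rewrite linearP.
Qed.

(* [raw n m x] is the coefficient at m of
   Y(z_1)(I ⊗ Y(z_2)) z_12^n e^(theta12 S12) x. *)
Definition raw_term n (m : mon2) (r j : nat) (x : tensor3 V) : V :=
  yz (m.1.1 - n + j%:Z, (m.1.2 - r)%N)
    (iy (m.2.1 - j%:Z, m.2.2) (eop r s12 ((-1) ^+ j *: bop n s12 j x))).

Definition raw n (m : mon2) (x : tensor3 V) : V :=
  \sum_(r < m.1.2.+1) \sum_(j \in [set: nat]) raw_term n m r j x.

Lemma iy_bounded_orbit (i : int) k (N : {linear tensor3 V -> tensor3 V}) x :
  (exists Q, iter Q N x = 0) ->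
  exists L : nat, forall j, (L <= j)%N -> forall e, iy (i - j%:Z, k) (iter e N x) = 0.
Proof.
move=> nilx; have [B BP] := bounded_orbit (fun y => iy_bounded A k y) nilx.
by exists (B + `|i|)%N => j jL e; apply: BP; lia.
Qed.

Lemma raw_bound n (m : mon2) x : exists L, forall j r, (L <= j)%N ->
  iy (m.2.1 - j%:Z, m.2.2) (eop r s12 ((-1) ^+ j *: bop n s12 j x)) = 0.
Proof.
have [L LP] := iy_bounded_orbit m.2.1 m.2.2 (s12_nilp A x).
exists L => j r jL; rewrite [eop _ _ _]linearZ /= linearZ /=.
have b0 := bop_kill (f := iy (m.2.1 - j%:Z, m.2.2)) (LP _ jL) n j.
by have /= -> := eop_kill b0 r 0; rewrite scaler0.
Qed.

Lemma YIY12_dser n (c : K) x (m : mon2) :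
  YIY12 (Y A) (dser n (fun r j => c *: eop r s12 ((-1) ^+ j *: bop n s12 j x))) m =
  c *: raw n m x.
Proof.
have [L LP] := raw_bound n m x.
rewrite /YIY12 (@sapp2_dser _ _ _ _ _ _ _ _ L).
- rewrite scaler_sumr; apply: eq_bigr => r _.
  rewrite (fsbig_nat (L := L)) => [|j /LP]; last first.
    by rewrite /raw_term => ->; rewrite linear0.
  rewrite scaler_sumr; apply: eq_bigr => j _.
  by rewrite linearZ linearZ.
- by move=> q; rewrite linear0.
- by move=> q; rewrite linear0.
- by move=> r j jL; rewrite -[LHS]/(iy _ (c *: _)) linearZ /= LP // scaler0.
Qed.

Lemma YIY12_raw n x (m : mon2) :
  YIY12 (Y A) (smul (iota12 K n) (sexp (theta12 K) (op12 S) x)) m = raw n m x.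
Proof.
rewrite -[op12 S : _ -> _]/(s12 : _ -> _) smul_iota12; last exact: s12_nilp.
rewrite -[RHS]scale1r -YIY12_dser; congr (YIY12 _ _ _).
by apply: eq_dser => r j; rewrite scale1r.
Qed.

Lemma YIY21_raw n (c : K) x (m : mon2) :
  YIY21 (Y A) (smul (fun m => c * iota12 K n (mswap m))
                 (sexp (theta21 K) (op12 S) x)) m = c *: raw n (mswap m) x.
Proof.
rewrite YIY21_swap -YIY12_dser; congr (YIY12 _ _ _).
apply/funext => q; rewrite /= smul_theta21 mswapK.
rewrite -[op12 S : _ -> _]/(s12 : _ -> _) smul_iota12; last exact: s12_nilp.
by rewrite /dser; case: ifP => _ //; rewrite scaler0.
Qed.

Lemma raw_linear n m : linear (raw n m).
Proof.
move=> k x y; rewrite scaler_sumr -big_split; apply: eq_bigr => r _ /=.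
pose F j : {linear tensor3 V -> V} := yz (m.1.1 - n + j%:Z, (m.1.2 - r)%N) \o
  (iy (m.2.1 - j%:Z, m.2.2) \o (eop r s12 \o (( *:%R ((-1) ^+ j)) \o bop n s12 j))).
apply: (@fsbig_linear _ _ F) => {k x y} x; have [L LP] := raw_bound n m x.
by exists L => j jL; rewrite /F /= LP // linear0.
Qed.
HB.instance Definition _ n m :=
  GRing.isLinear.Build K (tensor3 V) V *:%R (raw n m) (raw_linear n m).

(** The Koszul sum of the statement and the sign inside P12 are the same, for arbitrary a and b. *)
Lemma koszul_p12 (W : lmodType K) (f : {linear tensor3 V -> W}) a b c :
  koszul (fun a' b' => f (b' ⊗ a' ⊗ c)) a b = f (p12 (a ⊗ b ⊗ c)).
Proof.
rewrite p12E /flip bilift_tens /koszul -[_ ⊗ c]/(tensl c _) linear_sum linear_sum.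
apply: eq_bigr => p _; rewrite linear_sum linear_sum; apply: eq_bigr => q _.
by rewrite !linearZ.
Qed.

Lemma koszul_fun (I : Type) (W : lmodType K) (f : V -> V -> I -> W) a b m :
  koszul f a b m = koszul (fun a b => f a b m) a b.
Proof.
rewrite /koszul fct_sumE; apply: eq_bigr => p _.
by rewrite fct_sumE.
Qed.

Lemma raw_locality a b : exists N : nat, forall c m,
  raw N m (a ⊗ b ⊗ c) = (-1) ^+ N *: raw N (mswap m) (p12 (a ⊗ b ⊗ c)).
Proof.
have [N NP] := locality A a b; exists N => c m; rewrite -YIY12_raw -spow_z12.
rewrite NP koszul_fun -koszul_p12 /koszul scaler_sumr.
apply: eq_bigr => p _; rewrite scaler_sumr; apply: eq_bigr => q _.
rewrite spow_z12_swap spow_z12 YIY21_raw.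
by rewrite scalerA mulrC -scalerA.
Qed.

End ModeExpansion.

Section LogarithmPart.
Context {K : numFieldType} {V : superType K} (A : logVA V).
Local Notation S := (braid A).
Local Notation s12 := (s12 A).
Local Notation s23 := (s23 A).
Local Notation yz := (yz A).
Local Notation iy := (iy A).
Local Notation tV := (tassocV V V V).

Lemma iy_vac i k t : (i < 0) || (0 < k)%N -> iy (i, k) (t ⊗ vac A) = 0.
Proof.
move=> ik; apply: (tens_ext (f := iy (i, k) \o tensl (vac A)) (g := \0)) => a b.
by rewrite /= /tensl -tassocV_tens iyE yzE Y_vacr // tens0r.
Qed.

Lemma iy_vac0 t : iy (0, 0%N) (t ⊗ vac A) = t.
Proof.
apply: (tens_ext (f := iy (0, 0%N) \o tensl (vac A)) (g := idfun)) => a b.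
by rewrite /= /tensl -tassocV_tens iyE yzE Y_vacr0.
Qed.

Lemma eop_s12_tens r j n (t : tensor V V) c :
  eop r s12 ((-1) ^+ j *: bop n s12 j (t ⊗ c)) =
  eop r S ((-1) ^+ j *: bop n S j t) ⊗ c.
Proof.
have sE y : tensl c (S y) = s12 (tensl c y) by rewrite /tensl s12E.
rewrite -[t ⊗ c]/(tensl c t) -(bop_intertwine sE) -[_ *: tensl c _]linearZ /=.
by rewrite -(eop_intertwine sE).
Qed.

(* The z_2^0 zeta_2^0 coefficient of the locality axiom on a ⊗ b ⊗ vac. *)
Lemma yz_log_rec p k t : (0 < k)%N ->
  \sum_(r < k.+1) yz (p, (k - r)%N) (eop r S t) = 0.
Proof.
move=> k0; pose f : tensor V V -> V :=
  fun t => \sum_(r < k.+1) yz (p, (k - r)%N) (eop r S t).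
have fl : linear f.
  move=> c x y; rewrite /f scaler_sumr -big_split; apply: eq_bigr => r _.
  by rewrite /= !linearP.
pose F := HB.pack_for {linear tensor V V -> V} f (GRing.isLinear.Build _ _ _ _ f fl).
apply: (tens_ext (f := F) (g := \0)) t => a b; rewrite /F /= /f.
(* The shift by [N] compensates z_1^N, the j = 0 term of z_12^N; the terms j > 0 ask for negative
   powers in Y(b, z_2) applied to the vacuum. On the other side the inner field must supply zeta^k
   with k > 0 on the vacuum, so that side is 0. *)
have [N /(_ (vac A) ((p + N%:Z, k), (0, 0%N)))] := raw_locality A a b.
rewrite {2}/raw /mswap /= big_ord1 [X in _ *: X]fsbig1 ?scaler0 => [rawE|j _]; last first.
  rewrite /raw_term /= p12E eop_s12_tens iy_vac ?linear0 //.
  by rewrite k0 orbT.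
rewrite -[RHS]rawE /raw; apply: eq_bigr => r _.
rewrite (fsbig_nat (L := 1)) => [|j j0].
  rewrite big_ord1 /raw_term eop_s12_tens /= subr0 iy_vac0 scale1r ?addr0.
  by rewrite addrK.
rewrite /raw_term /= eop_s12_tens iy_vac ?linear0 //; apply/orP; left; lia.
Qed.

(** [yz_log_rec] says that Y(z) e^(zeta S) is free of zeta. Since e^(-zeta S) e^(zeta S) = 1, the
    coefficients of e^(-zeta S) obey the same triangular recursion, and strong induction on k
    identifies the two. *)
Lemma yz_log i k t : yz (i, k) t = yz (i, 0%N) (eop k (\- S) t).
Proof.
elim/ltn_ind: k t => -[|k] IH t; first by rewrite eop0.
have /eqP := yz_log_rec i (k := k.+1) t isT.
rewrite big_ord_recl -[nat_of_ord (@ord0 k.+1)]/0%N subn0 eop0 addr_eq0 => /eqP ->.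
have /eqP : eop k.+1 (\- S \+ S) t = 0.
  by rewrite (eq_eop (N := \0)) ?eop_zero // => y; rewrite /= addNr.
rewrite -eop_binomial => [|y]; last by rewrite /= linearN.
rewrite [X in X == _]big_ord_recl -[nat_of_ord (@ord0 k.+1)]/0%N subn0 eop0.
rewrite addr_eq0 => /eqP ->.
rewrite [RHS]linearN; congr (- _); rewrite [RHS]linear_sum.
by apply: eq_bigr => r _; rewrite IH // lift0; lia.
Qed.

Lemma iy_log i k x : iy (i, k) x = iy (i, 0%N) (eop k (\- s23) x).
Proof.
rewrite -[x](tassocK (U := V)); move: (tassoc V V V x) => {}x.
apply: (tens_ext (f := iy (i, k) \o tV)
  (g := iy (i, 0%N) \o (eop k (\- s23) \o tV))) => a t /=.
have sE y : (tV \o tensr a) ((\- S) y) = (\- s23) ((tV \o tensr a) y).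
  by rewrite /= /tensr s23E -[_ ⊗ _]/(tensr a (- S y)) !linearN.
rewrite -[tV (a ⊗ t)]/((tV \o tensr a) t) -(eop_intertwine sE) /= /tensr.
by rewrite !iyE yz_log.
Qed.

End LogarithmPart.

Definition md {K : numFieldType} {V : superType K} (A : logVA V) (n : int)
  (t : tensor V V) : V := yz A (- n - 1, 0%N) t.
HB.instance Definition _ (K : numFieldType) (V : superType K) (A : logVA V) n :=
  GRing.Linear.copy (md A n) (yz A (- n - 1, 0%N)).
Arguments md : simpl never.

Definition t1 {K : numFieldType} {V : superType K} (A : logVA V)
  (t : tensor V V) : tensor V V := tmap (transl A) idfun t.
HB.instance Definition _ (K : numFieldType) (V : superType K) (A : logVA V) :=
  GRing.Linear.copy (t1 A) (tmap (transl A) idfun).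
Definition t2 {K : numFieldType} {V : superType K} (A : logVA V)
  (t : tensor V V) : tensor V V := tmap idfun (transl A) t.
HB.instance Definition _ (K : numFieldType) (V : superType K) (A : logVA V) :=
  GRing.Linear.copy (t2 A) (tmap idfun (transl A)).
Arguments t1 : simpl never.
Arguments t2 : simpl never.

Section Translation.
Context {K : numFieldType} {V : superType K} (A : logVA V).
Local Notation S := (braid A).
Local Notation s23 := (s23 A).
Local Notation yz := (yz A).
Local Notation yi := (yi A).
Local Notation p23 := (@p23 K V).
Local Notation T := (transl A).
Local Notation T1 := (t1 A).
Local Notation T2 := (t2 A).
Local Notation md := (md A).

Lemma t1E a b : T1 (a ⊗ b) = T a ⊗ b. Proof. exact: tmap_tens. Qed.
Lemma t2E a b : T2 (a ⊗ b) = a ⊗ T b. Proof. exact: tmap_tens. Qed.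

(** Covariance at zeta = 0. The zeta-derivative in D_z picks the coefficient of zeta, which is -S by
    [yz_log]; this turns the classical factor n into n + S. *)
Lemma md_T2 n t : md n (T2 t) = T (md n t) + md (n - 1) (n%:~R *: t + S t).
Proof.
have dz i : T (yz (i, 0%N) t) - yz (i, 0%N) (T2 t) =
    (i + 1)%:~R *: yz (i + 1, 0%N) t - yz (i + 1, 0%N) (S t).
  have Y1 u : yz (i + 1, 1%N) u = - yz (i + 1, 0%N) (S u).
    by rewrite yz_log /eop invr1 scale1r /= linearN.
  rewrite -Y1; apply: (tens_ext
    (f := (T \o yz (i, 0%N)) \- (yz (i, 0%N) \o T2))
    (g := (( *:%R (i + 1)%:~R) \o yz (i + 1, 0%N)) \+ yz (i + 1, 1%N))) => a b /=.
  rewrite t2E !yzE.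
  have /(congr1 (fun f => f (i, 0%N))) := covariance A a b.
  by rewrite /Dz /= scale1r.
move: (dz (- n - 1)); rewrite subrK -/(md n t) -/(md n (T2 t)) => /eqP.
have yzm u : yz (- n, 0%N) u = md (n - 1) u.
  by rewrite /md; congr (yz (_, _) _); lia.
rewrite !yzm subr_eq => /eqP ->.
rewrite [md _ (_ + _)]linearD /= [md _ (_ *: _)]linearZ rmorphN /= scaleNr.
by rewrite -opprD addrAC addNr add0r.
Qed.

(** This is Y(a, z)1 = e^(zT) a. As T and S both kill the vacuum, [md_T2] becomes the recursion for
    the coefficients of e^(zT). *)
Lemma md_vac i a : md (- 1 - i%:Z) (a ⊗ vac A) = eop i T a.
Proof.
elim: i => [|i IH].
  by rewrite eop0 /md (_ : - (-1 - 0%:Z) - 1 = 0) // yzE Y_vacr0.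
apply: (scalerI_nat (n := i)); rewrite eopS -IH.
have := md_T2 (-1 - i%:Z) (a ⊗ vac A).
rewrite t2E transl_vac tens0r linear0 S_vacr addr0 linearZ /=.
move/eqP; rewrite eq_sym addr_eq0 => /eqP ->.
rewrite (_ : -1 - i%:Z - 1 = - 1 - i.+1%:Z); last by lia.
rewrite -scaleNr -[i.+1%:R]/(i.+1%:Z%:~R) -rmorphN /=; congr (_%:~R *: _); lia.
Qed.

(** T b is the coefficient of z in Y(b, z)1, so the hexagon identity applies to T, and its S23 term
    vanishes on the vacuum. *)
Lemma S_T1 t : S (T1 t) = T1 (S t).
Proof.
apply: (tens_ext (f := S \o T1) (g := T1 \o S)) => a c /=.
rewrite t1E.
have TE b : T b = yz (1, 0%N) (b ⊗ vac A).
  by rewrite -[RHS]/(md (-1 - 1%:Z) (b ⊗ vac A)) md_vac /eop invr1 scale1r.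
rewrite TE -yiE S_yi s13_vac linearD /=.
rewrite -[X in s23 X]tassocV_tens s23E S_vacl tens0r !linear0 addr0.
apply: (tens_ext (f := yi (1, 0%N) \o (p23 \o tensl (vac A))) (g := T1)) => u v.
by rewrite /= /tensl p23_vacr yiE t1E -TE.
Qed.

Lemma flip_T1 t : flip V (T1 t) = T2 (flip V t).
Proof.
apply: (homog_tens_ext (f := flip V \o T1) (g := T2 \o flip V)) => p q a b pa qb /=.
have Tpa : has_parity p (T a) by have := transl_even A pa; rewrite addbF.
rewrite t1E (flip_homog Tpa qb) (flip_homog pa qb) linearZ /=.
by rewrite t2E.
Qed.

Lemma S_T2 t : S (T2 t) = T2 (S t).
Proof.
by rewrite -[t]flipK -flip_T1 S_flip S_T1 flip_T1 -S_flip.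
Qed.

(** Iterating [md_T2] produces the factors n + S, n - 1 + S, and so on, which collect into
    binomial(n + S, i) because S commutes with T2. *)
Lemma md_T2_exp n s t :
  md n (eop s T2 t) =
  \sum_(i < s.+1) eop (s - i) T (md (n - i%:Z) (bop n S i t)).
Proof.
elim: s t => [|s IH] t; first by rewrite big_ord1 !eop0 subr0.
apply: (scalerI_nat (n := s)).
pose F i := eop (s.+1 - i) T (md (n - i%:Z) (bop n S i t)).
have -> : s.+1%:R *: md n (eop s.+1 T2 t) = md n (eop s T2 (T2 t)).
  rewrite -[LHS]linearZ eopS; congr (md n _).
  exact: (eop_intertwine (M := T2) (N := T2) (g := T2)).
rewrite IH scaler_sumr.
have -> : \sum_(i < s.+2) s.+1%:R *: F i =
  \sum_(i < s.+2) (s.+1 - i)%:R *: F i + \sum_(i < s.+2) i%:R *: F i.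
  rewrite -big_split; apply: eq_bigr => i _ /=.
  by rewrite -scalerDl -natrD subnK // -ltnS.
rewrite [X in X + _]big_ord_recr /= subnn scale0r addr0.
rewrite [X in _ + X]big_ord_recl scale0r add0r -big_split; apply: eq_bigr => i _.
have is' : (i <= s)%N by rewrite -ltnS.
rewrite lift0 /F subSS subSn // eopS.
have bT : bop n S i (T2 t) = T2 (bop n S i t).
  by apply/esym/(bop_intertwine (M := S) (N := S) (g := T2)) => y; rewrite S_T2.
rewrite bT md_T2 linearD /=; congr (_ + _).
  by rewrite (eop_intertwine (M := T) (N := T) (g := T)).
rewrite -[RHS]linearZ -[X in _ = eop _ _ X]linearZ bopS.
congr (eop _ _ (md _ _)); last first.
by rewrite -addrA -opprD; congr (n - _); lia.
Qed.

End Translation.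

(** * The identity in modes *)

Section FiniteSumManipulations.

Lemma sum_antidiag (W : nmodType) (G : nat -> nat -> W) t :
  \sum_(j < t) \sum_(s < t - j) G j s = \sum_(q < t) \sum_(j < q.+1) G j (q - j)%N.
Proof.
elim: t => [|t IH]; first by rewrite !big_ord0.
rewrite [RHS]big_ord_recr /= -IH [LHS]big_ord_recr /= subSnn big_ord1.
rewrite [X in _ = _ + X]big_ord_recr /= subnn addrA -big_split; congr (_ + _).
by apply: eq_bigr => j _; rewrite /= subSn ?big_ord_recr // ltnW.
Qed.

Lemma uniform_bound (P : nat -> nat -> Prop) L :
  (forall j, exists B, forall i, (B <= i)%N -> P j i) ->
  exists B, forall j, (j < L)%N -> forall i, (B <= i)%N -> P j i.
Proof.
move=> PB; elim: L => [|L [B IH]]; first by exists 0%N.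
have [B' BP] := PB L; exists (B + B')%N => j; rewrite ltnS leq_eqVlt.
move=> /predU1P[->|jL] i iB; first by apply: BP; lia.
by apply: IH => //; lia.
Qed.

End FiniteSumManipulations.

Section Signs.
Variable K : numFieldType.
Implicit Types m n : int.

Definition sg n : K := (-1) ^ n.

Lemma sgD m n : sg (m + n) = sg m * sg n.
Proof. by rewrite /sg expfzDr // oppr_eq0 oner_eq0. Qed.
Lemma sg_nat (n : nat) : sg n%:Z = (-1) ^+ n.
Proof. by []. Qed.
Lemma sgN n : sg (- n) = sg n.
Proof. by case: n => n; rewrite /sg ?NegzE ?opprK -?invr_expz -!exprnP invr_sign. Qed.
Lemma sgK n : sg n * sg n = 1.
Proof. by rewrite -{1}sgN -sgD addNr. Qed.
Lemma sg1 : sg 1 = -1.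
Proof. by []. Qed.

End Signs.

Definition im {K : numFieldType} {V : superType K} (A : logVA V) (k : int)
  (x : tensor3 V) : tensor V V := iy A (- k - 1, 0%N) x.
HB.instance Definition _ (K : numFieldType) (V : superType K) (A : logVA V) k :=
  GRing.Linear.copy (im A k) (iy A (- k - 1, 0%N)).
Definition mi {K : numFieldType} {V : superType K} (A : logVA V) (k : int)
  (x : tensor3 V) : tensor V V := yi A (- k - 1, 0%N) x.
HB.instance Definition _ (K : numFieldType) (V : superType K) (A : logVA V) k :=
  GRing.Linear.copy (mi A k) (yi A (- k - 1, 0%N)).
Arguments im : simpl never.
Arguments mi : simpl never.

Section ModalIdentities.
Context {K : numFieldType} {V : superType K} (A : logVA V).
Local Notation S := (braid A).
Local Notation s12 := (s12 A).
Local Notation s13 := (s13 A).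
Local Notation T := (transl A).
Local Notation T2 := (t2 A).
Local Notation md := (md A).
Local Notation im := (im A).
Local Notation mi := (mi A).

(** Moving T2 out of the mode by [md_T2_exp] creates binomial(p + r - j + S, s), and S acts through
    f as M + N. On each antidiagonal q = j + s, [bop_conv] absorbs binomial(r + N, j) and leaves
    binomial(p + M, q). *)
Lemma translate_binomial (U : lmodType K) (f : {linear U -> tensor V V})
    (M N : {linear U -> U}) : (forall u, M (N u) = N (M u)) ->
  (forall u, S (f u) = f (M u + N u)) -> forall p r t u,
  \sum_(j < t.+1) (-1) ^+ (t - j) *:
     md (p + r - j%:Z) (eop (t - j) T2 (f (bop r N j u))) =
  (-1) ^+ t *: \sum_(q < t.+1) eop (t - q) T (md (p + r - q%:Z) (f (bop p M q u))).
Proof.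
move=> MN Sf p r t u.
pose G j s := (-1) ^+ (t - j) *: eop (t - j - s) T (md (p + r - j%:Z - s%:Z)
  (f (bop (p + r - j%:Z) (M \+ N) s (bop r N j u)))).
transitivity (\sum_(j < t.+1) \sum_(s < t.+1 - j) G j s).
  apply: eq_bigr => j _; have jt : (j <= t)%N by rewrite -ltnS.
  rewrite md_T2_exp scaler_sumr subSn //; apply: eq_bigr => s _; rewrite /G.
  by rewrite -(bop_intertwine (M := M \+ N) (N := S) (g := f)).
rewrite sum_antidiag scaler_sumr; apply: eq_bigr => q _.
have qt : (q <= t)%N by rewrite -ltnS.
pose g : {linear U -> V} := eop (t - q) T \o (md (p + r - q%:Z) \o f).
transitivity ((-1) ^+ (t - q) *: g (\sum_(j < q.+1) (-1) ^+ (q - j) *: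
     bop (p + r - j%:Z) (M \+ N) (q - j) (bop r N j u))); last first.
  by rewrite bop_conv // [g _]linearZ scalerA -exprD subnK.
rewrite [g _]linear_sum scaler_sumr; apply: eq_bigr => j _.
have jq : (j <= q)%N by rewrite -ltnS.
rewrite [g _]linearZ scalerA -exprD addnBA // subnK // /G /g /=.
congr (_ *: eop _ _ (md _ _)); first by lia.
by lia.
Qed.

Lemma md_bounded t : exists B : nat, forall k : int, B%:Z <= k -> md k t = 0.
Proof.
have [B BP] := yz_bounded A 0 t; exists B => k kB; apply: BP; lia.
Qed.

Lemma im_bounded (N : {linear tensor3 V -> tensor3 V}) x :
  (exists Q, iter Q N x = 0) ->
  exists B : nat, forall k n j, B%:Z <= k -> im k (bop n N j x) = 0.
Proof.
move=> nilx; have [B BP] := bounded_orbit (fun y => iy_bounded A 0 y) nilx.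
exists B => k n j kB; apply: (bop_kill (f := im k) _ n j 0) => e.
by apply: BP; lia.
Qed.

Lemma mi_bounded (N : {linear tensor3 V -> tensor3 V}) x :
  (exists Q, iter Q N x = 0) ->
  exists B : nat, forall k n j, B%:Z <= k -> mi k (bop n N j x) = 0.
Proof.
move=> nilx; have [B BP] := bounded_orbit (fun y => yi_bounded A 0 y) nilx.
exists B => k n j kB; apply: (bop_kill (f := mi k) _ n j 0) => e.
by apply: BP; lia.
Qed.

(* The modes of Y(z_1)(I ⊗ Y(z_2)) z_12^n (1 - z_2/z_1)^S12 and of
   Y(z_2)(mu_(n+j) ⊗ I) (d/dz_2 + S13/z_2)^(j) delta(z_1, z_2). *)
Definition nested m n k x : V :=
  \sum_(j \in [set: nat]) (-1) ^+ j *: md (m + n - j%:Z) (im (k + j%:Z) (bop n s12 j x)).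
Definition iterate m n k x : V :=
  \sum_(j \in [set: nat]) md (m + k - j%:Z) (mi (n + j%:Z) (bop m s13 j x)).

Lemma nested_bounded x : exists B : nat, forall m n k (L : nat), B%:Z <= k + L%:Z ->
  nested m n k x =
  \sum_(j < L) (-1) ^+ j *: md (m + n - j%:Z) (im (k + j%:Z) (bop n s12 j x)).
Proof.
have [B BP] := im_bounded (s12_nilp A x); exists B => m n k L LB.
by apply: fsbig_nat => j jL; rewrite BP ?linear0 ?scaler0 //; lia.
Qed.

Lemma iterate_bounded x : exists B : nat, forall m n k (L : nat), B%:Z <= n + L%:Z ->
  iterate m n k x =
  \sum_(j < L) md (m + k - j%:Z) (mi (n + j%:Z) (bop m s13 j x)).
Proof.
have [B BP] := mi_bounded (s13_nilp A x); exists B => m n k L LB.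
by apply: fsbig_nat => j jL; rewrite BP ?linear0 //; lia.
Qed.

Lemma nested_is_linear m n k : linear (nested m n k).
Proof.
pose F j : {linear tensor3 V -> V} :=
  ( *:%R ((-1) ^+ j)) \o (md (m + n - j%:Z) \o (im (k + j%:Z) \o bop n s12 j)).
apply: (@fsbig_linear _ _ _ F) => x.
have [B BP] := im_bounded (s12_nilp A x); exists (B + `|k|)%N => j jL.
by rewrite /F /= BP ?linear0 ?scaler0 //; lia.
Qed.
HB.instance Definition _ m n k :=
  GRing.isLinear.Build K (tensor3 V) V *:%R (nested m n k) (nested_is_linear m n k).

(** Multiplication of the kernel by z_1 - z_2, read in modes through Pascal's rule for binomial(n +
    S12, j). *)
Lemma nested_rec m n k x :
  nested m (n + 1) k x = nested (m + 1) n k x - nested m n (k + 1) x.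
Proof.
have [B BP] := nested_bounded x; pose L := (B + `|k|)%N.
rewrite (BP m (n + 1) k L.+1) ?(BP (m + 1) n k L.+1) ?(BP m n (k + 1) L);
  try by rewrite /L; lia.
rewrite !big_ord_recl -[RHS]addrA; congr (_ + _).
  by congr (_ *: md _ _); rewrite /= ; lia.
rewrite -sumrB; apply: eq_bigr => j _.
rewrite lift0 bop_pascal !linearD /= scalerDr; congr (_ + _).
  by congr (_ *: md _ _); lia.
rewrite exprS mulN1r scaleNr; congr (- (_ *: md _ (im _ _))); lia.
Qed.

Lemma iterate_rec m n k x :
  iterate (m + 1) n k x = iterate m n (k + 1) x + iterate m (n + 1) k x.
Proof.
have [B BP] := iterate_bounded x; pose L := (B + `|n|)%N.
rewrite (BP (m + 1) n k L.+1) ?(BP m n (k + 1) L.+1) ?(BP m (n + 1) k L);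
  try by rewrite /L; lia.
rewrite !big_ord_recl -[RHS]addrA; congr (_ + _).
  by congr (md _ _); rewrite /= ; lia.
rewrite -big_split; apply: eq_bigr => j _.
rewrite lift0 bop_pascal !linearD /=; congr (_ + _).
  by congr (md _ _); lia.
by congr (md _ (mi _ _)); lia.
Qed.

End ModalIdentities.

(** * Locality and skew-symmetry in modes *)

Section ModalLocality.
Context {K : numFieldType} {V : superType K} (A : logVA V).
Local Notation S := (braid A).
Local Notation s12 := (s12 A).
Local Notation s13 := (s13 A).
Local Notation s23 := (s23 A).
Local Notation yz := (yz A).
Local Notation iy := (iy A).
Local Notation p12 := (@p12 K V).
Local Notation T := (transl A).
Local Notation T2 := (t2 A).
Local Notation md := (md A).
Local Notation im := (im A).
Local Notation sg := (@sg K).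
Local Notation nested := (nested A).

Lemma s12_neg_s13 x : s12 ((\- s13) x) = (\- s13) (s12 x).
Proof. by rewrite /= [s12 (- _)]linearN /= s12s13C. Qed.
Lemma s12_neg_s23 x : s12 ((\- s23) x) = (\- s23) (s12 x).
Proof. by rewrite /= [s12 (- _)]linearN /= s12s23C. Qed.

(** The outer e^(-zeta_1 S) passes the inner field as e^(-zeta_1 (S12 + S13)) and meets e^(zeta_1
    S12) from the kernel; e^(-zeta_1 S13) is left, beside e^(-zeta_2 S23) from the inner field. *)
Lemma raw_nested n p1 k1 p2 k2 x :
  raw A n ((p1, k1), (p2, k2)) x =
  nested (- p1 - 1) n (- p2 - 1) (eop k1 (\- s13) (eop k2 (\- s23) x)).
Proof.
set y := eop k1 _ _.
have [B BP] := nested_bounded A y.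
have rawB := raw_bound A n ((p1, k1), (p2, k2)) x.
have [L0 LP] := rawB; pose L := (L0 + B + `|p2| + 1)%N.
rewrite (BP _ _ _ L) /raw /=; last by rewrite /L; lia.
rewrite (eq_bigr (fun r : 'I_k1.+1 =>
  \sum_(j < L) raw_term A n ((p1, k1), (p2, k2)) r j x)).
  rewrite exchange_big; apply: eq_bigr => j _ /=.
  pose g : {linear tensor3 V -> V} := yz (p1 - n + j%:Z, 0%N) \o iy (p2 - j%:Z, 0%N).
  have E r z : yz (p1 - n + j%:Z, (k1 - r)%N) (iy (p2 - j%:Z, k2) z) =
      g (eop (k1 - r) (\- (s12 \+ s13)) (eop k2 (\- s23) z)).
    rewrite yz_log iy_log /g /=; congr (yz _ _).
    symmetry; apply: (eop_intertwine (g := iy (p2 - j%:Z, 0%N))) => u.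
    by rewrite /= linearN S_iy.
  transitivity (g ((-1) ^+ j *: bop n s12 j y)); last first.
    rewrite linearZ /= /g /=; congr (_ *: yz (_, _) (iy (_, _) _)); lia.
  transitivity (g (\sum_(r < k1.+1) eop (k1 - r) (\- (s12 \+ s13))
      (eop r s12 ((-1) ^+ j *: eop k2 (\- s23) (bop n s12 j x))))).
    rewrite [RHS]linear_sum; apply: eq_bigr => r _.
    rewrite /raw_term /= E; congr (g (eop _ _ _)).
    have C u : eop k2 (\- s23) (s12 u) = s12 (eop k2 (\- s23) u).
      exact/esym/(eop_intertwine (g := s12) s12_neg_s23).
    by rewrite (eop_intertwine (g := eop k2 (\- s23)) C) /= [eop k2 _ (_ *: _)]linearZ.
  congr (g _); rewrite eop_binomial; last first.
    by move=> u; rewrite /= [s12 (- _)]linearN /= [s12 (_ + _)]linearD /= -s12s13C.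
  rewrite (eq_eop (N := \- s13)) => [|u]; last by rewrite /= opprD addrAC addNr add0r.
  rewrite [LHS]linearZ; congr (_ *: _); rewrite /y /=.
  have C2 u : eop k2 (\- s23) (s12 u) = s12 (eop k2 (\- s23) u).
    exact/esym/(eop_intertwine (g := s12) s12_neg_s23).
  have C1 u : eop k1 (\- s13) (s12 u) = s12 (eop k1 (\- s13) u).
    exact/esym/(eop_intertwine (g := s12) s12_neg_s13).
  by rewrite (bop_intertwine (g := eop k2 (\- s23)) C2)
    (bop_intertwine (g := eop k1 (\- s13)) C1).
move=> r _; apply: fsbig_nat => j jL.
by rewrite /raw_term LP ?linear0 //; move: jL; rewrite /L; lia.
Qed.

Lemma raw_nested0 n p1 p2 x :
  raw A n ((p1, 0%N), (p2, 0%N)) x = nested (- p1 - 1) n (- p2 - 1) x.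
Proof. by rewrite raw_nested !eop0. Qed.

Lemma locality_step n x :
  (forall m k, nested m n k x = sg n *: nested k n m (p12 x)) ->
  (forall m k, nested m (n + 1) k x = sg (n + 1) *: nested k (n + 1) m (p12 x)).
Proof.
move=> H m k; rewrite !nested_rec !H sgD sg1 mulrN1 scaleNr -scalerN opprB.
by rewrite scalerBr.
Qed.

(** The axiom gives one exponent per pair a, b. Locality survives raising the exponent
    ([locality_step]), so finitely many pure tensors share an exponent. *)
Lemma nested_locality x : exists N : nat, forall n, N%:Z <= n ->
  forall m k, nested m n k x = sg n *: nested k n m (p12 x).
Proof.
have step (n0 : nat) y :
    (forall m k, nested m n0%:Z k y = sg n0%:Z *: nested k n0%:Z m (p12 y)) ->
    forall n, n0%:Z <= n -> forall m k, nested m n k y = sg n *: nested k n m (p12 y).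
  move=> H n nn0; have -> : n = n0%:Z + `|n - n0%:Z|%N%:Z by lia.
  elim: `|n - n0%:Z|%N => [|d IH]; first by rewrite addr0.
  rewrite (_ : n0%:Z + d.+1%:Z = n0%:Z + d%:Z + 1); last by lia.
  exact: locality_step.
have split2 m n k u v : nested m n k (u + v) = nested m n k u + nested m n k v.
  exact: linearD.
have splitp u v : p12 (u + v) = p12 u + p12 v by exact: linearD.
rewrite (tens_sum x); elim: (repr x) => [|[t c] r [N IH]].
  exists 0%N => n _ m k; rewrite big_nil [p12 0]linear0.
  by rewrite [nested _ _ _ 0]linear0 [nested _ _ _ 0]linear0 scaler0.
rewrite big_cons /=.
suff [N' H] : exists N : nat, forall n, N%:Z <= n ->
    forall m k, nested m n k (t ⊗ c) = sg n *: nested k n m (p12 (t ⊗ c)).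
  exists (N + N')%N => n nN m k; rewrite splitp !split2 scalerDr H ?IH //; lia.
rewrite (tens_sum t) -[_ ⊗ c]/(tensl c _) linear_sum /=.
elim: (repr t) => [|[a b] s [N' IHs]].
  exists 0%N => n _ m k; rewrite big_nil [p12 0]linear0.
  by rewrite [nested _ _ _ 0]linear0 [nested _ _ _ 0]linear0 scaler0.
have [N0 H0] := raw_locality A a b.
exists (N' + N0)%N => n nN m k; rewrite big_cons splitp !split2 scalerDr.
congr (_ + _); last by apply: IHs; lia.
apply: (step N0) => [|]; last by lia.
move=> {}m {}k; have := H0 c ((- m - 1, 0%N), (- k - 1, 0%N)).
rewrite /mswap /= !raw_nested0 (_ : - (- m - 1) - 1 = m); last by lia.
by rewrite (_ : - (- k - 1) - 1 = k); last by lia.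
Qed.

Lemma im_vac_ge0 (n : nat) t : im n%:Z (t ⊗ vac A) = 0.
Proof. by rewrite /im iy_vac //; lia. Qed.

Lemma im_vac i t : im (- 1 - i%:Z) (t ⊗ vac A) = eop i T2 t.
Proof.
apply: (tens_ext (f := im (- 1 - i%:Z) \o tensl (vac A)) (g := eop i T2)) => a b.
rewrite /= /tensl -tassocV_tens /im iyE -[yz _ _]/(md (-1 - i%:Z) (b ⊗ vac A)) md_vac.
have C y : tensr a (T y) = T2 (tensr a y) by rewrite /tensr t2E.
exact: (eop_intertwine (g := tensr a) C).
Qed.

Lemma bop_s12_tens n j t c : bop n s12 j (t ⊗ c) = bop n S j t ⊗ c.
Proof.
symmetry; apply: (bop_intertwine (g := tensl c)) => u.
by rewrite /= /tensl s12E.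
Qed.

(* Locality with the vacuum as third vector, at z_2 = 0. *)
Lemma skew_symmetry n t :
  md n (flip V t) =
  \sum_(i \in [set: nat]) sg (n + 1 + i%:Z) *: eop i T (md (n + i%:Z) t).
Proof.
have [B BP] := md_bounded A t.
have [N0 NP] := nested_locality (flip V t ⊗ vac A).
(* With inner mode -1 one side of locality is the single term [md n]. On the other side the inner
   modes n - N + j act on the vacuum, hence need j <= d = N - n - 1; and N >= B makes the claimed
   sum stop at d too. *)
pose N := (N0 + B + `|n| + 1)%N.
pose d := absz (N%:Z - n - 1)%R; have dE : d%:Z = N%:Z - n - 1 by rewrite /d /N; lia.
have N0N : N0%:Z <= N%:Z by rewrite /N; lia.
have := NP _ N0N (n - N%:Z) (-1); rewrite p12E flipK.
have -> : nested (n - N%:Z) N%:Z (-1) (flip V t ⊗ vac A) = md n (flip V t).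
  rewrite /nested (fsbig_nat (L := 1)) => [|j j1].
    rewrite big_ord1 scale1r bop_s12_tens addr0 subr0 subrK.
    by rewrite (im_vac 0) eop0.
  rewrite bop_s12_tens (_ : -1 + j%:Z = j.-1%:Z); last by lia.
  by rewrite im_vac_ge0 linear0 scaler0.
move=> ->.
have -> : nested (-1) N%:Z (n - N%:Z) (t ⊗ vac A) =
    \sum_(q < d.+1) (-1) ^+ q *: eop (d - q) T (md (n + (d - q)%N%:Z) t).
  rewrite /nested (fsbig_nat (L := d.+1)) => [|j dj]; last first.
    rewrite bop_s12_tens (_ : n - N%:Z + j%:Z = (j - d.+1)%N%:Z); last by lia.
    by rewrite im_vac_ge0 linear0 scaler0.
  have zS u : (\0 : tensor V V -> tensor V V) (S u) =
      S ((\0 : tensor V V -> tensor V V) u).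
    by rewrite linear0.
  have idS u : S (idfun u) = idfun ((\0 : tensor V V -> tensor V V) u + S u).
    by rewrite /= add0r.
  (* With M = 0 and p = -1 the remaining binomial is binomial(-1, q) = (-1)^q. *)
  have := translate_binomial zS idS (-1) N%:Z d t.
  move/(congr1 (fun v => (-1) ^+ d *: v)).
  rewrite scalerA -expr2 sqrr_sign scale1r scaler_sumr => tb.
  transitivity (\sum_(q < d.+1) eop (d - q) T (md (-1 + N%:Z - q%:Z) (bop (-1) \0 q t))).
    rewrite -[RHS]tb; apply: eq_bigr => j _; have jd : (j <= d)%N by rewrite -ltnS.
    rewrite scalerA -exprD; congr (_ *: md _ _).
      rewrite (_ : (d + (d - j) = j + 2 * (d - j))%N); last by lia.
      by rewrite exprD exprM sqrrN !expr1n mulr1.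
    rewrite bop_s12_tens (_ : n - N%:Z + j%:Z = -1 - (d - j)%N%:Z); last by lia.
    by rewrite im_vac.
  apply: eq_bigr => q _; have qd : (q <= d)%N by rewrite -ltnS.
  rewrite bop_minus1 linearZ linearZ /=; congr (_ *: eop _ _ (md _ _)); lia.
rewrite (fsbig_nat (L := d.+1)) => [|i di]; last first.
  by rewrite BP ?linear0 ?scaler0 //; rewrite /N in dE; lia.
rewrite (sum_ord_rev d (fun i => sg (n + 1 + i%:Z) *: eop i T (md (n + i%:Z) t))).
rewrite scaler_sumr; apply: eq_bigr => q _.
have qd : (q <= d)%N by rewrite -ltnS.
rewrite scalerA -sg_nat -[sg q%:Z]sgN -sgD; congr (sg _ *: _); lia.
Qed.

End ModalLocality.

(** * Associativity and the Borcherds identity in modes *)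

Section Associativity.
Context {K : numFieldType} {V : superType K} (A : logVA V).
Local Notation S := (braid A).
Local Notation s12 := (s12 A).
Local Notation s13 := (s13 A).
Local Notation yz := (yz A).
Local Notation p12 := (@p12 K V).
Local Notation p23 := (@p23 K V).
Local Notation tV := (tassocV V V V).
Local Notation T := (transl A).
Local Notation T2 := (t2 A).
Local Notation md := (md A).
Local Notation im := (im A).
Local Notation mi := (mi A).
Local Notation sg := (@sg K).
Local Notation nested := (nested A).
Local Notation iterate := (iterate A).

Definition skew_term n i : {linear tensor V V -> V} :=
  ( *:%R (sg (n + 1 + i%:Z))) \o (eop i T \o md (n + i%:Z)).

Lemma skew_term_bound n t : exists L, forall i, (L <= i)%N -> skew_term n i t = 0.
Proof.
have [B BP] := md_bounded A t; exists (B + `|n|)%N => i iL.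
by rewrite /skew_term /= BP ?linear0 ?scaler0 //; lia.
Qed.

Definition im_skew_term k i : {linear tensor3 V -> tensor V V} :=
  ( *:%R (sg (k + 1 + i%:Z))) \o (eop i T2 \o im (k + i%:Z)).

Lemma im_skew_bound k y : exists L, forall i, (L <= i)%N -> im_skew_term k i y = 0.
Proof.
have [B BP] := bounded_orbit (fun y => iy_bounded A 0 y) (s12_nilp A y).
exists (B + `|k|)%N => i iL; rewrite /im_skew_term /=.
have /= := BP (- (k + i%:Z) - 1) _ 0.
by rewrite /im => ->; rewrite ?linear0 ?scaler0 //; lia.
Qed.

Lemma im_flip k y :
  im k (p23 y) = \sum_(i \in [set: nat]) im_skew_term k i y.
Proof.
pose f (y : tensor3 V) : tensor V V := \sum_(i \in [set: nat]) im_skew_term k i y.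
have fl : linear f := fsbig_linear (im_skew_bound k).
pose F := HB.pack_for {linear tensor3 V -> tensor V V} f
  (GRing.isLinear.Build _ _ _ _ f fl).
rewrite -[y](tassocK (U := V)); move: (tassoc V V V y) => {}y.
apply: (tens_ext (f := im k \o (p23 \o tV)) (g := F \o tV)) => a t.
rewrite -[RHS]/(\sum_(i \in [set: nat]) im_skew_term k i (tV (a ⊗ t))).
rewrite -[LHS]/(im k (p23 (tV (a ⊗ t)))) p23E /im iyE.
rewrite -[yz _ _]/(md k (flip V t)) skew_symmetry.
have [L LP] := skew_term_bound k t.
have E i : im_skew_term k i (tV (a ⊗ t)) = tensr a (skew_term k i t).
  have C u : tensr a (T u) = T2 (tensr a u) by rewrite /tensr t2E.
  rewrite /im_skew_term /skew_term /= [RHS]linearZ /= (eop_intertwine (g := tensr a) C).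
  by rewrite /im iyE.
transitivity (tensr a (\sum_(i < L) skew_term k i t)).
  by rewrite -(fsbig_nat LP).
rewrite linear_sum (fsbig_nat (L := L)) => [|i iL]; last by rewrite E LP // linear0.
by apply: eq_bigr => i _; rewrite E.
Qed.

(** The common form of both sides of associativity: a nested product in the order a, c, b, followed
    by the coefficients of an exponential of T. Its kernel has exponent [m], so locality of a and c
    applies once m is large. *)
Definition swapped m n k w : V :=
  \sum_(i \in [set: nat]) sg (k + 1 + i%:Z) *: eop i T (nested n m (k + i%:Z) w).

(* Skew-symmetry for the inner field. *)
Lemma nested_swap m n k x : nested m n k x = swapped m n k (p23 x).
Proof.
rewrite -{1}[x]p23K; set w := p23 x.
have [B1 B1P] := im_bounded A (s13_nilp A w).
have [B2 B2P] := im_bounded A (s12_nilp A w).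
pose L := (B1 + B2 + `|k|)%N.
have bp n' j : bop n' s12 j (p23 w) = p23 (bop n' s13 j w).
  by apply/esym/(bop_intertwine (g := p23)) => u; rewrite /= p23_s13.
have bL1 n' t j : (L <= t)%N -> im (k + t%:Z) (bop n' s13 j w) = 0.
  by move=> tL; apply: B1P; move: tL; rewrite /L; lia.
have bL2 n' t j : (L <= t)%N -> im (k + t%:Z) (bop n' s12 j w) = 0.
  by move=> tL; apply: B2P; move: tL; rewrite /L; lia.
pose G j i := (-1) ^+ j *: md (m + n - j%:Z) (sg (k + j%:Z + 1 + i%:Z) *:
  eop i T2 (im (k + (j + i)%N%:Z) (bop n s13 j w))).
have imE j : im (k + j%:Z) (bop n s12 j (p23 w)) =
    \sum_(i < L - j) sg (k + j%:Z + 1 + i%:Z) *: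
       eop i T2 (im (k + (j + i)%N%:Z) (bop n s13 j w)).
  rewrite bp im_flip (fsbig_nat (L := L - j)) => [|i iL].
    apply: eq_bigr => i _; rewrite /im_skew_term /=.
    by rewrite (_ : k + j%:Z + i%:Z = k + (j + i)%N%:Z); last by lia.
  rewrite /im_skew_term /= (_ : k + j%:Z + i%:Z = k + (j + i)%N%:Z); last by lia.
  by rewrite bL1 ?linear0 ?scaler0 //; lia.
have -> : nested m n k (p23 w) = \sum_(j < L) \sum_(i < L - j) G j i.
  rewrite /nested (fsbig_nat (L := L)) => [|j jL]; last first.
    rewrite imE (_ : (L - j = 0)%N) ?big_ord0 ?linear0 ?scaler0 //; lia.
  by apply: eq_bigr => j _; rewrite imE [md _ _]linear_sum scaler_sumr.
pose H i q := sg (k + 1 + i%:Z) *: ((-1) ^+ q *: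
  eop i T (md (n + m - q%:Z) (im (k + (i + q)%N%:Z) (bop m s12 q w)))).
have nE i : nested n m (k + i%:Z) w = \sum_(q < L - i)
    (-1) ^+ q *: md (n + m - q%:Z) (im (k + (i + q)%N%:Z) (bop m s12 q w)).
  rewrite /nested (fsbig_nat (L := L - i)) => [|q qL].
    apply: eq_bigr => q _.
    by rewrite (_ : k + i%:Z + q%:Z = k + (i + q)%N%:Z); last by lia.
  rewrite (_ : k + i%:Z + q%:Z = k + (i + q)%N%:Z); last by lia.
  by rewrite bL2 ?linear0 ?scaler0 //; lia.
have -> : swapped m n k w = \sum_(i < L) \sum_(q < L - i) H i q.
  rewrite /swapped (fsbig_nat (L := L)) => [|i iL]; last first.
    rewrite nE (_ : (L - i = 0)%N) ?big_ord0 ?linear0 ?scaler0 //; lia.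
  apply: eq_bigr => i _; rewrite nE [eop _ _ _]linear_sum scaler_sumr.
  by apply: eq_bigr => q _; rewrite /H; congr (_ *: _); rewrite [LHS]linearZ.
(* For fixed t = j + i the inner mode k + t is constant, and the claim is [translate_binomial] for f
   = [im (k + t)], through which S acts as S12 + S13. *)
rewrite !sum_antidiag; apply: eq_bigr => t _.
have Sf u : S (im (k + t%:Z) u) = im (k + t%:Z) (s12 u + s13 u) by rewrite /im S_iy.
have tb := translate_binomial (s12s13C A) Sf m n t w.
transitivity (sg (k + 1) *: ((-1) ^+ t *: \sum_(q < t.+1)
   eop (t - q) T (md (m + n - q%:Z) (im (k + t%:Z) (bop m s12 q w))))).
  rewrite -tb scaler_sumr; apply: eq_bigr => j _.
  have jt : (j <= t)%N by rewrite -ltnS.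
  rewrite /G subnKC // [md _ (_ *: _)]linearZ /= !scalerA -!sg_nat -!sgD.
  congr (_ *: _).
  rewrite (_ : j%:Z + _ = k + 1 + (t - j)%N%:Z + (j%:Z + j%:Z)); last by lia.
  by rewrite sgD [sg (j%:Z + j%:Z)]sgD sgK mulr1.
rewrite [RHS](sum_ord_rev t (fun i => H i (t - i)%N)) !scaler_sumr.
apply: eq_bigr => q _; have qt : (q <= t)%N by rewrite -ltnS.
rewrite /H subKn // subnK // !scalerA -!sg_nat -!sgD [n + m]addrC.
congr (_ *: _); rewrite (_ : k + 1 + t%:Z = k + 1 + (t - q)%N%:Z + q%:Z) //; lia.
Qed.

(* Skew-symmetry for the outer field, then locality of a and c. *)
Lemma iterate_swap x : exists M : nat, forall m, M%:Z <= m -> forall n k,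
  iterate m n k x = swapped m n k (p23 x).
Proof.
have [M MP] := nested_locality A (p23 x); exists M => m mM n k.
set y := p12 (p23 x).
have [B BP] := iterate_bounded A x; have [B' B'P] := nested_bounded A y.
pose L1 := (B + B' + `|n|)%N.
rewrite (BP _ _ _ L1); last by rewrite /L1; lia.
pose u j := im (n + j%:Z) (bop m s12 j y).
have fE j : mi (n + j%:Z) (bop m s13 j x) = flip V (u j).
  rewrite -[LHS]flipK /mi flip_yi; congr (flip V (im _ _)).
  rewrite -[p12 _]/((p12 \o p23) _) (bop_intertwine (N := s12)) // => v.
  by rewrite /= p23_s13 p12_s12.
(* The truncation of skew-symmetry depends on j through [u j]; only the j < L1 matter, so one bound
   suffices and the sums can be exchanged. *)
have [L2 L2P] : exists L2, forall j, (j < L1)%N -> forall i, (L2 <= i)%N ->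
    md (m + k - j%:Z + i%:Z) (u j) = 0.
  apply: uniform_bound => j; have [Bj BjP] := md_bounded A (u j).
  by exists (Bj + `|(m + k - j%:Z)%R|)%N => i iB; apply: BjP; lia.
have [B3 B3P] := nested_bounded A (p23 x).
pose L := (L2 + B3 + `|k|)%N.
rewrite /swapped (fsbig_nat (L := L)) => [|i iL]; last first.
  rewrite (B3P _ _ _ 0%N) ?big_ord0 ?linear0 ?scaler0 //.
  by move: iL; rewrite /L; lia.
transitivity (\sum_(j < L1) \sum_(i < L)
    sg (m + k - j%:Z + 1 + i%:Z) *: eop i T (md (m + k - j%:Z + i%:Z) (u j))).
  apply: eq_bigr => j _; rewrite fE skew_symmetry; apply: fsbig_nat => i iL.
  by rewrite L2P ?linear0 ?scaler0 //; move: iL; rewrite /L; lia.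
rewrite exchange_big; apply: eq_bigr => i _.
rewrite MP // (B'P _ _ _ L1) -/y; last by rewrite /L1; lia.
rewrite [eop _ _ _]linearZ /= scalerA -sgD [X in _ = _ *: X]linear_sum scaler_sumr.
apply: eq_bigr => j _; rewrite [X in _ = _ *: X]linearZ /= [RHS]scalerA.
rewrite -sg_nat -[sg j%:Z]sgN -sgD.
rewrite (_ : k + 1 + i%:Z + m + - j%:Z = m + k - j%:Z + 1 + i%:Z); last by lia.
by rewrite (_ : k + i%:Z + m - j%:Z = m + k - j%:Z + i%:Z); last by lia.
Qed.

(* The defect J of the identity satisfies z_12 J_n = J_(n+1). It vanishes for
   n large by locality and for m large by the two swap lemmas, so descending
   induction on n kills it: J_(n+1) = 0 makes J_n constant on the lines m + k. *)
Lemma modal_borcherds m n k x :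
  nested m n k x - sg n *: nested k n m (p12 x) = iterate m n k x.
Proof.
pose J m n k := nested m n k x - sg n *: nested k n m (p12 x) - iterate m n k x.
suff J0 : forall m n k, J m n k = 0.
  by apply/eqP; rewrite -subr_eq0; apply/eqP/J0.
have Jrec m' n' k' : J m' (n' + 1) k' = J (m' + 1) n' k' - J m' n' (k' + 1).
  rewrite /J !nested_rec iterate_rec sgD sg1 mulrN1 scaleNr opprK scalerBr.
  set a := nested _ _ _ _; set b := nested _ _ _ _.
  set c := _ *: nested _ _ _ _; set d := _ *: nested _ _ _ _.
  set e := iterate _ _ _ _; set f := iterate _ _ _ _.
  rewrite !opprD !opprK.
  by rewrite [RHS](AC (2*2*3) ((1*5)*(6*2)*4*(3*7))) /= addNr addr0.
have [N NP] : exists N : nat, forall m n k, N%:Z <= n -> J m n k = 0.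
  have [N1 N1P] := nested_locality A x; have [N2 N2P] := iterate_bounded A x.
  exists (N1 + N2)%N => m' n' k' nN.
  rewrite /J (N2P _ _ _ 0%N) ?big_ord0 ?subr0; last by lia.
  by rewrite -N1P ?subrr //; lia.
have [M MP] : exists M : nat, forall m n k, M%:Z <= m -> J m n k = 0.
  have [M1 M1P] := iterate_swap x; have [M2 M2P] := nested_bounded A (p12 x).
  exists (M1 + M2)%N => m' n' k' mM.
  rewrite /J (M2P _ _ _ 0%N) ?big_ord0 ?scaler0 ?subr0; last by lia.
  by rewrite M1P -?nested_swap ?subrr //; lia.
have desc (d : nat) : forall m n k, N%:Z <= n + d%:Z -> J m n k = 0.
  elim: d => [|d IH] m' n' k' nd; first by apply: NP; lia.
  have step m2 k2 : J (m2 + 1) n' k2 = J m2 n' (k2 + 1).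
    by apply/eqP; rewrite -subr_eq0 -Jrec; apply/eqP/IH; lia.
  have shift e m2 k2 : J m2 n' k2 = J (m2 + e%:Z) n' (k2 - e%:Z).
    elim: e m2 k2 => [|e IHe] m2 k2; first by rewrite addr0 subr0.
    rewrite IHe (_ : m2 + e.+1%:Z = m2 + e%:Z + 1); last by lia.
    by rewrite step (_ : k2 - e.+1%:Z + 1 = k2 - e%:Z); last by lia.
  by rewrite (shift (M + `|m'|)%N) MP //; lia.
by move=> m' n' k'; apply: (desc (N + `|n'|)%N); lia.
Qed.

End Associativity.

(** * From modes back to formal series *)

Section BorcherdsIdentity.
Context {K : numFieldType} {V : superType K} (A : logVA V).
Local Notation S := (braid A).
Local Notation s13 := (s13 A).
Local Notation s23 := (s23 A).
Local Notation yz := (yz A).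
Local Notation yi := (yi A).
Local Notation p12 := (@p12 K V).
Local Notation md := (md A).
Local Notation mi := (mi A).
Local Notation iterate := (iterate A).

Lemma sapp_in_z2 (X W : nmodType) (f : mon1 -> X -> W) (H : mon2 -> X) (m : mon2) l :
  (forall q, f q 0 = 0) ->
  (forall q : mon2, q.1 = m.1 -> H q <> 0 -> q.2.1 = l) ->
  sapp (in_z2 f) H m =
  \sum_(s < m.2.2.+1) f (m.2.1 - l, (m.2.2 - s)%N) (H (m.1, (l, s : nat))).
Proof.
move=> f0 Hl; rewrite /sapp.
pose h (s : 'I_m.2.2.+1) : mon2 * mon2 :=
  (((0, 0%N), (m.2.1 - l, (m.2.2 - s)%N)), (m.1, (l, s : nat))).
rewrite (cauchy_fin (h := h)).
- by apply: eq_bigr => s _; rewrite /in_z2 eqxx.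
- by move=> s s' [] _ ss'; apply: val_inj.
- move=> s; have := ltn_ord s; rewrite ltnS /h /=; move: (nat_of_ord s) => i.
  case: (m) => [[a b] [e k]] /= ik.
  by congr ((_, _), (_, _)); rewrite /= ?add0r ?subrK // /GRing.add /= subnK.
- suff P (p q : mon2) : p + q = m -> in_z2 f p (H q) <> 0 -> exists s, h s = (p, q).
    by move=> p q; exact: P.
  rewrite /in_z2; case: eqP => //; case: p => p1 [i k] /= -> pq fn.
  have q1 : q.1 = m.1 by rewrite -pq /= add0r.
  have ql : q.2.1 = l by apply: Hl => // H0; apply: fn; rewrite H0.
  have qs : (q.2.2 < m.2.2.+1)%N by rewrite -pq /= /GRing.add /=; lia.
  exists (Ordinal qs); rewrite /h /=.
  have -> : m.2.1 - l = i by rewrite -pq /= ql addrK.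
  have -> : (m.2.2 - q.2.2)%N = k by rewrite -pq /= /GRing.add /=; lia.
  by rewrite -q1 -ql; case: q {pq fn q1 ql qs} => [q1 [? ?]].
Qed.

Lemma s13_neg_s23 x : s13 ((\- s23) x) = (\- s23) (s13 x).
Proof. by rewrite /= [s13 (- _)]linearN /= s13s23C. Qed.

Lemma eop_s13_s23C k1 k2 x :
  eop k1 (\- s13) (eop k2 (\- s23) x) = eop k2 (\- s23) (eop k1 (\- s13) x).
Proof.
have C u : (\- s23) (eop k1 (\- s13) u) = eop k1 (\- s13) ((\- s23) u).
  apply: (eop_intertwine (g := \- s23)) => v.
  by rewrite /= [s23 (- _)]linearN [s13 (- _)]linearN /= s13s23C.
exact/(eop_intertwine (g := eop k1 (\- s13)))/(fun u => esym (C u)).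
Qed.

(** P12 exchanges S13 and S23, so e^(-zeta_1 S13 - zeta_2 S23) is unchanged when both the variables
    and the vectors a, b are swapped. *)
Lemma p12_eop k1 k2 x :
  eop k2 (\- s13) (eop k1 (\- s23) (p12 x)) =
  p12 (eop k1 (\- s13) (eop k2 (\- s23) x)).
Proof.
rewrite eop_s13_s23C.
rewrite (eop_intertwine (g := p12) (N := \- s23)) => [|u]; last first.
  by rewrite /= [p12 (- _)]linearN /= p12_s13.
rewrite (eop_intertwine (g := p12) (N := \- s13)) // => u.
by rewrite /= [p12 (- _)]linearN /= p12_s23.
Qed.

(** The field Y(z_2) brings e^(-zeta_2 S), which passes mu ⊗ I as e^(-zeta_2 (S13 + S23)); the
    factor e^(zeta_2 S13) of delta cancels its S13 part. *)
Lemma rhs_term n (j : nat) p1 k1 p2 k2 (x : tensor3 V) :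
  sapp (in_z2 (fun m => Yz (Y A) m : tensor V V -> V))
    (fun m => tmap (mu (Y A) (n + j%:Z)) idfun
       (Dz2_div j (deltaN (op13 S) x) m)) ((p1, k1), (p2, k2)) =
  md (- p1 - 1 + (- p2 - 1) - j%:Z) (mi (n + j%:Z)
    (bop (- p1 - 1) s13 j (eop k1 (\- s13) (eop k2 (\- s23) x)))).
Proof.
(* The exponent of z_2 that the support of the j-th derivative of delta imposes beside z_1^p1; then
   l + j = - p1 - 1 is the upper index of the binomial. *)
pose l : int := - p1 - j.+1%:Z.
have DE m : Dz2_div j (deltaN (op13 S) x) m = if m.1.1 + m.2.1 == - j.+1%:Z
    then bop (m.2.1 + j%:Z) s13 j (eop m.2.2 s13 (eop m.1.2 (\- s13) x)) else 0.
  rewrite -[op13 S : _ -> _]/(s13 : _ -> _); apply: Dz2_div_deltaN.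
  exact: s13_nilp.
rewrite (@sapp_in_z2 _ _ _ _ _ l) => [|q|q q1]; last 2 first.
- exact: linear0.
- rewrite DE; case: eqP => [+ _|_]; last by rewrite linear0.
  by rewrite q1 /l /=; lia.
rewrite /=; pose g : {linear tensor3 V -> V} := yz (p2 - l, 0%N) \o mi (n + j%:Z).
transitivity (g (\sum_(s < k2.+1) eop (k2 - s) (\- (s13 \+ s23))
    (eop s s13 (bop (- p1 - 1) s13 j (eop k1 (\- s13) x))))).
  rewrite linear_sum; apply: eq_bigr => s _.
  rewrite -[LHS]/(yz _ (mi (n + j%:Z) _)) DE /= ifT; last by rewrite /l; lia.
  rewrite yz_log /g /=; congr (yz _ _).
  rewrite (_ : l + j%:Z = - p1 - 1); last by rewrite /l; lia.
  have Sm u : mi (n + j%:Z) ((\- (s13 \+ s23)) u) = (\- S) (mi (n + j%:Z) u).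
    by rewrite /mi /= S_yi [yi _ (- _)]linearN.
  rewrite (eop_intertwine (g := mi (n + j%:Z)) Sm); congr (eop _ _ (mi _ _)).
  symmetry; apply: (bop_intertwine (g := eop s s13)) => u.
  exact/esym/(eop_intertwine (g := s13)).
rewrite eop_binomial => [|u]; last first.
  by rewrite /= [s13 (- _)]linearN /= [s13 (_ + _)]linearD /= s13s23C.
rewrite (eq_eop (N := \- s23)) => [|u]; last by rewrite /= opprD addrAC addNr add0r.
rewrite eop_s13_s23C /g /= /md; congr (yz (_, _) (mi _ _)).
  by rewrite /l; lia.
apply: (bop_intertwine (g := eop k2 (\- s23))) => u.
exact/esym/(eop_intertwine (g := s13) s13_neg_s23).
Qed.

Theorem borcherds_identity (a b c : V) (n : int) :
  YIY12 (Y A)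
    (smul (iota12 K n) (sexp (theta12 K) (op12 S) (a ⊗ b ⊗ c)))
  - koszul (fun a' b' =>
      YIY21 (Y A)
        (smul (iota21 K n) (sexp (theta21 K) (op12 S) (b' ⊗ a' ⊗ c)))) a b
  = formal_sum [set: nat] (fun j : nat =>
      sapp (in_z2 (fun m => Yz (Y A) m : tensor V V -> V))
        (fun m => tmap (mu (Y A) (n + j%:Z)) idfun
                    (Dz2_div j (deltaN (op13 S) (a ⊗ b ⊗ c)) m))).
Proof.
apply/funext => -[[p1 k1] [p2 k2]]; rewrite !fctE /formal_sum.
under [RHS]eq_fsbigr => j _ do rewrite rhs_term.
rewrite -[RHS]/(iterate (- p1 - 1) n (- p2 - 1) _) -modal_borcherds YIY12_raw raw_nested.
congr (_ - _).
pose f : {linear tensor3 V -> V} := ( *:%R (sg K n)) \o raw A n ((p2, k2), (p1, k1)).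
transitivity (f (p12 (a ⊗ b ⊗ c))); last first.
  by rewrite /f /= raw_nested p12_eop.
rewrite koszul_fun -koszul_p12; apply: eq_bigr => p _; apply: eq_bigr => q _.
congr (_ *: _); rewrite (_ : iota21 K n = fun m => sg K n * iota12 K n (mswap m)).
  by rewrite YIY21_raw.
by apply/funext => m; rewrite iota21E.
Qed.

End BorcherdsIdentity.

Theorem theorem3p26 (R : realType) (V : superType R[i]) (A : logVA V)
    (a b c : V) (n : int) :
  YIY12 (Y A)
    (smul (iota12 R[i] n)
       (sexp (theta12 R[i]) (op12 (braid A)) (a ⊗ b ⊗ c)))
  - koszul (fun a' b' =>
      YIY21 (Y A)
        (smul (iota21 R[i] n)
           (sexp (theta21 R[i]) (op12 (braid A)) (b' ⊗ a' ⊗ c)))) a b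
  = formal_sum [set: nat] (fun j : nat =>
      sapp (in_z2 (fun m => Yz (Y A) m : tensor V V -> V))
        (fun m => tmap (mu (Y A) (n + j%:Z)) idfun
                    (Dz2_div j (deltaN (op13 (braid A)) (a ⊗ b ⊗ c)) m))).
Proof. exact: (@borcherds_identity R[i] V A a b c n). Qed.
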